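(* Let $\phi$ be a Drinfeld $A$-module over a field $L$ with characteristic $\mathfrak p=\ker\iota$, and let $\mathfrak q$ be a nonzero prime of $A$ with $\mathfrak q\neq\mathfrak p$. There is a Galois-equivariant continuous perfect pairing of $A_{\mathfrak q}$-modules $$[\;,\;]_{\mathfrak q}:T_{\mathfrak q}(\phi)\times T_{\mathfrak q}(\phi^\ast)\to\operatorname{Hom}_{\mathbb F_q}(K_{\mathfrak q}/A_{\mathfrak q},\mathbb F_q),$$ and $\operatorname{Hom}_{\mathbb F_q}(K_{\mathfrak q}/A_{\mathfrak q},\mathbb F_q)$ is (non-canonically) isomorphic to $A_{\mathfrak q}$ as an $A_{\mathfrak q}$-module.
   Context: Let $q$ be a power of a prime $p$, $X$ a nonsingular projective curve over $\mathbb F_q$, $\infty$ a closed point, $A$ the ring of regular functions on $X\setminus\{\infty\}$, $K$ its fraction field, and $A_{\mathfrak q},K_{\mathfrak q}$ the completions at $\mathfrak q$. Let $L$ be a field with an $\mathbb F_q$-algebra homomorphism $\iota:A\to L$; a Drinfeld $A$-module over $L$ is a ring homomorphism $\phi:A\to L\{\tau\}$, $a\mapsto\phi_a=\sum c_i\tau^i$ (acting on $\overline L$ by $z\mapsto\sum c_iz^{q^i}$, multiplication = composition) with $\tau^0$-coefficient $\iota(a)$ and image not in $L$. The adjoint of $\sum c_n\tau^n$ is $\sum c_n^{1/q^n}\tau^{-n}$, acting on $\overline L$ via $z\mapsto\sum c_n^{1/q^n}z^{1/q^n}$. Let $\phi(\overline L)$ (resp. $\phi^\ast(\overline L)$) be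 $\overline L$ with $A$ acting by $c\cdot z=\phi_c(z)$ (resp. $\phi_c^\ast(z)$). The Tate modules are $T_{\mathfrak q}(\phi)=\operatorname{Hom}_A(K_{\mathfrak q}/A_{\mathfrak q},\phi(\overline L))$ and $T_{\mathfrak q}(\phi^\ast)=\operatorname{Hom}_A(K_{\mathfrak q}/A_{\mathfrak q},\phi^\ast(\overline L))$, $A_{\mathfrak q}$-modules with their natural profinite topologies, on which automorphisms of $\overline L$ over $L$ act. $\operatorname{Hom}_{\mathbb F_q}(K_{\mathfrak q}/A_{\mathfrak q},\mathbb F_q)$ is an $A_{\mathfrak q}$-module via $(c\cdot\chi)(x)=\chi(cx)$, with trivial Galois action. Perfect means both induced maps into $\operatorname{Hom}_{A_{\mathfrak q}}(\,\cdot\,,\operatorname{Hom}_{\mathbb F_q}(K_{\mathfrak q}/A_{\mathfrak q},\mathbb F_q))$ are isomorphisms. *)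

(* Defs.v *)
From HB Require Import structures.
From mathcomp Require Import all_boot all_order all_algebra all_field.
From mathcomp Require Import all_classical topology.

Set Implicit Arguments.
Unset Strict Implicit.
Unset Printing Implicit Defensive.

Import GRing.Theory.
Local Open Scope ring_scope.

Section Frobenius.
Variables (Fq : finFieldType) (L : fieldType) (k : {rmorphism Fq -> L}).

Lemma pnat_card n : [pchar L].-nat (#|Fq| ^ n)%N.
Proof.
have [p p_pr cFp] := finPcharP Fq.
have cLp : p \in [pchar L] by apply: (rmorph_pchar k).
rewrite pnatX; apply/orP; left.
rewrite (eq_pnat _ (pcharf_eq cLp)).
have := card_pprimeChar cFp; rewrite /= => ->.
by rewrite pnatX pnat_id.
Qed.

Lemma frobD n (x y : L) :
  (x + y) ^+ (#|Fq| ^ n) = x ^+ (#|Fq| ^ n) + y ^+ (#|Fq| ^ n).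
Proof. exact: exprDn_pchar (pnat_card n). Qed.

Lemma frob0 n : 0 ^+ (#|Fq| ^ n) = 0 :> L.
Proof. by rewrite expr0n expn_eq0; case: #|Fq| (fintype0 (0 : Fq)) => [[]|]. Qed.

Lemma frob_inj n : injective (fun x : L => x ^+ (#|Fq| ^ n)).
Proof.
move=> x y xy; apply/eqP; rewrite -subr_eq0; apply/eqP.
have: (x - y) ^+ (#|Fq| ^ n) = 0.
  by apply: (addIr (y ^+ (#|Fq| ^ n))); rewrite -frobD subrK add0r.
by move/eqP; rewrite expf_eq0 => /andP[_ /eqP].
Qed.

End Frobenius.

Section SumCoef.
Variables (R : nzRingType) (V : zmodType) (F : nat -> R -> V).
Hypothesis FD : forall i x y, F i (x + y) = F i x + F i y.

Definition sum_coef (f : {poly R}) := \sum_(i < size f) F i f`_i.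

Let F0 i : F i 0 = 0.
Proof. by apply: (addIr (F i 0)); rewrite -FD !add0r. Qed.

Lemma sum_coef_wide N (f : {poly R}) :
  (size f <= N)%N -> sum_coef f = \sum_(i < N) F i f`_i.
Proof.
move=> leN; rewrite /sum_coef (big_ord_widen _ (fun i => F i f`_i) leN) big_mkcond.
by apply: eq_bigr => i _; case: ltnP => // ?; rewrite nth_default.
Qed.

Lemma sum_coefD f g : sum_coef (f + g) = sum_coef f + sum_coef g.
Proof.
pose N := maxn (size (f + g)) (maxn (size f) (size g)).
rewrite !(@sum_coef_wide N) ?leq_max ?leqnn ?orbT //.
by rewrite -big_split; apply: eq_bigr => i _; rewrite coefD FD.
Qed.

Lemma sum_coef0 : sum_coef 0 = 0.
Proof. by rewrite /sum_coef size_poly0 big_ord0. Qed.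

Lemma sum_coefZX a n : sum_coef (a *: 'X^n) = F n a.
Proof.
rewrite (@sum_coef_wide n.+1); last first.
  by apply: leq_trans (size_scale_leq _ _) _; rewrite size_polyXn.
rewrite big_ord_recr /= big1 ?add0r => [|i _].
  by rewrite coefZ coefXn eqxx mulr1.
by rewrite coefZ coefXn ltn_eqF ?mulr0 //= F0.
Qed.

End SumCoef.

Lemma poly_add_ind (R : nzRingType) (P : {poly R} -> Prop) :
  P 0 -> (forall f g, P f -> P g -> P (f + g)) ->
  (forall a n, P (a *: 'X^n)) -> forall f, P f.
Proof.
move=> P0 PD PX f; rewrite -[f]coefK poly_def.
by apply: (big_ind P) => // i _; apply: PX.
Qed.

(* [twisted k] is L{tau}: the coefficient of tau^i of f is f`_i, and the       *)
(* product is determined by (a tau^i) (b tau^j) = a b^(q^i) tau^(i+j) with     *)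
(* q = #|Fq|. The argument k makes L an Fq-algebra.                            *)
Definition twisted (Fq : finFieldType) (L : fieldType)
  (k : {rmorphism Fq -> L}) : Type := {poly L}.

Section Twisted.
Variables (Fq : finFieldType) (L : fieldType) (k : {rmorphism Fq -> L}).
Local Notation q := #|Fq|.

HB.instance Definition _ := GRing.Zmodule.copy (twisted k) {poly L}.

Definition twisted_mul (f g : {poly L}) : {poly L} :=
  \sum_(i < size f) \sum_(j < size g) (f`_i * g`_j ^+ (q ^ i)) *: 'X^(i + j).

Let rowF (g : {poly L}) i (a : L) : {poly L} :=
  \sum_(j < size g) (a * g`_j ^+ (q ^ i)) *: 'X^(i + j).
Let colF i a j (b : L) : {poly L} := (a * b ^+ (q ^ i)) *: 'X^(i + j).

Let rowFD g i a b : rowF g i (a + b) = rowF g i a + rowF g i b.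
Proof. by rewrite -big_split; apply: eq_bigr => j _; rewrite mulrDl scalerDl. Qed.
Let colFD i a j b c : colF i a j (b + c) = colF i a j b + colF i a j c.
Proof. by rewrite /colF (frobD k) mulrDr scalerDl. Qed.

Lemma twisted_mulDl : left_distributive twisted_mul +%R.
Proof. by move=> f g h; apply: (sum_coefD (rowFD h)). Qed.

Lemma twisted_mulDr : right_distributive twisted_mul +%R.
Proof.
move=> f g h; rewrite -big_split; apply: eq_bigr => i _.
exact: (sum_coefD (colFD i f`_i)).
Qed.

Lemma twisted_mul0l f : twisted_mul 0 f = 0.
Proof. by rewrite /twisted_mul size_poly0 big_ord0. Qed.

Lemma twisted_mul0r f : twisted_mul f 0 = 0.
Proof. by rewrite /twisted_mul big1 // => i _; rewrite size_poly0 big_ord0. Qed.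

Lemma twisted_mulX a b i j :
  twisted_mul (a *: 'X^i) (b *: 'X^j) = (a * b ^+ (q ^ i)) *: 'X^(i + j).
Proof.
by rewrite [LHS](sum_coefZX (rowFD _)) /rowF; exact: (sum_coefZX (colFD i a)).
Qed.

Lemma twisted_mulA : associative twisted_mul.
Proof.
move=> f g h; elim/poly_add_ind: f => [|f f' IH IH'|a i].
- by rewrite !twisted_mul0l.
- by rewrite !twisted_mulDl IH IH'.
elim/poly_add_ind: g => [|g g' IH IH'|b j].
- by rewrite twisted_mul0l twisted_mul0r twisted_mul0l.
- by rewrite twisted_mulDl !twisted_mulDr twisted_mulDl IH IH'.
elim/poly_add_ind: h => [|h h' IH IH'|c l].
- by rewrite !twisted_mul0r.
- by rewrite !twisted_mulDr IH IH'.
by rewrite !twisted_mulX addnA exprMn -exprM mulrA -expnD addnC.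
Qed.

Lemma twisted_mul1l : left_id 1 twisted_mul.
Proof.
have -> : 1 = 1 *: 'X^0 :> {poly L} by rewrite scale1r expr0.
elim/poly_add_ind => [|f f' IH IH'|a i]; first exact: twisted_mul0r.
  by rewrite twisted_mulDr IH IH'.
by rewrite twisted_mulX mul1r expn0 expr1.
Qed.

Lemma twisted_mul1r : right_id 1 twisted_mul.
Proof.
have -> : 1 = 1 *: 'X^0 :> {poly L} by rewrite scale1r expr0.
elim/poly_add_ind => [|f f' IH IH'|a i]; first exact: twisted_mul0l.
  by rewrite twisted_mulDl IH IH'.
by rewrite twisted_mulX expr1n mulr1 addn0.
Qed.

HB.instance Definition _ := GRing.Zmodule_isNzRing.Build (twisted k)
  twisted_mulA twisted_mul1l twisted_mul1r twisted_mulDl twisted_mulDr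
  (oner_neq0 {poly L}).

End Twisted.

Section Action.
Variables (Fq : finFieldType) (L : fieldType) (Lbar : closedFieldType).
Variables (k : {rmorphism Fq -> L}) (emb : {rmorphism L -> Lbar}).
Local Notation q := #|Fq|.

Definition twisted_act (f : twisted k) (z : Lbar) : Lbar :=
  \sum_(i < size (f : {poly L})) emb (f : {poly L})`_i * z ^+ (q ^ i).

(* Frobenius is bijective on Lbar, so this is the q^n-th root. *)
Definition qroot n (z : Lbar) : Lbar := xget 0 [set w | w ^+ (q ^ n) = z].

Definition adjoint_act (f : twisted k) (z : Lbar) : Lbar :=
  \sum_(i < size (f : {poly L})) qroot i (emb (f : {poly L})`_i) * qroot i z.

Let kbar : {rmorphism Fq -> Lbar} := emb \o k.

Lemma qrootK n z : qroot n z ^+ (q ^ n) = z.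
Proof.
have q_gt0 : (0 < q ^ n)%N.
  by rewrite expn_gt0; case: #|Fq| (fintype0 (0 : Fq)) => [[]|].
have [w Hw] := solve_monicpoly (fun i => if i == 0%N then z else 0) q_gt0.
suff E : exists w : Lbar, w ^+ (q ^ n) = z by exact: (xgetPex 0 E).
exists w; rewrite Hw; case: (q ^ n)%N q_gt0 => // m _.
by rewrite big_ord_recl /= expr0 mulr1 big1 ?addr0 // => i _; rewrite mul0r.
Qed.

Lemma qroot_eq n w z : w ^+ (q ^ n) = z -> qroot n z = w.
Proof. by move=> Hw; apply: (frob_inj kbar (n := n)); rewrite qrootK. Qed.

Lemma qrootD n x y : qroot n (x + y) = qroot n x + qroot n y.
Proof. by apply: qroot_eq; rewrite (frobD kbar) !qrootK. Qed.

Lemma qrootM n x y : qroot n (x * y) = qroot n x * qroot n y.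
Proof. by apply: qroot_eq; rewrite exprMn !qrootK. Qed.

Lemma qroot_qroot m n z : qroot m (qroot n z) = qroot (n + m) z.
Proof. by apply/esym/qroot_eq; rewrite expnD mulnC exprM !qrootK. Qed.

Lemma qrootX m n z : qroot (m + n) (z ^+ (q ^ m)) = qroot n z.
Proof. by apply: qroot_eq; rewrite expnD mulnC exprM qrootK. Qed.

Let actF z i a := emb a * z ^+ (q ^ i).
Let adjF z i a := qroot i (emb a) * qroot i z.
Let actFD z i a b : actF z i (a + b) = actF z i a + actF z i b.
Proof. by rewrite /actF rmorphD mulrDl. Qed.
Let adjFD z i a b : adjF z i (a + b) = adjF z i a + adjF z i b.
Proof. by rewrite /adjF rmorphD qrootD mulrDl. Qed.

Lemma twisted_actDl f g z : twisted_act (f + g) z = twisted_act f z + twisted_act g z.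
Proof. exact: (sum_coefD (actFD z)). Qed.

Lemma adjoint_actDl f g z : adjoint_act (f + g) z = adjoint_act f z + adjoint_act g z.
Proof. exact: (sum_coefD (adjFD z)). Qed.

Lemma twisted_actDr f x y : twisted_act f (x + y) = twisted_act f x + twisted_act f y.
Proof.
by rewrite -big_split; apply: eq_bigr => i _; rewrite (frobD kbar) mulrDr.
Qed.

Lemma adjoint_actDr f x y : adjoint_act f (x + y) = adjoint_act f x + adjoint_act f y.
Proof.
by rewrite -big_split; apply: eq_bigr => i _; rewrite qrootD mulrDr.
Qed.

Lemma twisted_act0 z : twisted_act 0 z = 0.
Proof. exact: (sum_coef0 (actF z)). Qed.

Lemma adjoint_act0 z : adjoint_act 0 z = 0.
Proof. exact: (sum_coef0 (adjF z)). Qed.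

Lemma twisted_act0r f : twisted_act f 0 = 0.
Proof. by apply: (addIr (twisted_act f 0)); rewrite -twisted_actDr !add0r. Qed.

Lemma adjoint_act0r f : adjoint_act f 0 = 0.
Proof. by apply: (addIr (adjoint_act f 0)); rewrite -adjoint_actDr !add0r. Qed.

Lemma twisted_actZX a n z : twisted_act (a *: 'X^n : {poly L}) z = emb a * z ^+ (q ^ n).
Proof. exact: (sum_coefZX (actFD z)). Qed.

Lemma adjoint_actZX a n z :
  adjoint_act (a *: 'X^n : {poly L}) z = qroot n (emb a) * qroot n z.
Proof. exact: (sum_coefZX (adjFD z)). Qed.

Lemma twisted_act1 z : twisted_act 1 z = z.
Proof.
have -> : (1 : twisted k) = (1 *: 'X^0 : {poly L}) by rewrite scale1r expr0.
by rewrite twisted_actZX rmorph1 mul1r expn0 expr1.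
Qed.

Lemma adjoint_act1 z : adjoint_act 1 z = z.
Proof.
have -> : (1 : twisted k) = (1 *: 'X^0 : {poly L}) by rewrite scale1r expr0.
have r0 x : qroot 0 x = x by apply: qroot_eq; rewrite expn0 expr1.
by rewrite adjoint_actZX !r0 rmorph1 mul1r.
Qed.

Lemma twisted_actM f g z : twisted_act (f * g) z = twisted_act f (twisted_act g z).
Proof.
elim/poly_add_ind: f => [|f f' IH IH'|a i].
- by rewrite [0 * _]mul0r !twisted_act0.
- by rewrite [(_ + _) * _]mulrDl !twisted_actDl IH IH'.
elim/poly_add_ind: g => [|g g' IH IH'|b j].
- by rewrite [_ * 0]mulr0 !twisted_act0 twisted_act0r.
- by rewrite [_ * (_ + _)]mulrDr !twisted_actDl twisted_actDr IH IH'.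
rewrite [_ * _](twisted_mulX k) !twisted_actZX rmorphM rmorphXn exprMn -mulrA.
by rewrite -exprM -expnD [(j + i)%N]addnC.
Qed.

Lemma adjoint_actM f g z : adjoint_act (f * g) z = adjoint_act g (adjoint_act f z).
Proof.
elim/poly_add_ind: f => [|f f' IH IH'|a i].
- by rewrite [0 * _]mul0r !adjoint_act0 adjoint_act0r.
- by rewrite [(_ + _) * _]mulrDl !adjoint_actDl adjoint_actDr IH IH'.
elim/poly_add_ind: g => [|g g' IH IH'|b j].
- by rewrite [_ * 0]mulr0 !adjoint_act0.
- by rewrite [_ * (_ + _)]mulrDr !adjoint_actDl IH IH'.
rewrite [_ * _](twisted_mulX k) !adjoint_actZX rmorphM rmorphXn !qrootM.
by rewrite !qroot_qroot qrootX mulrCA mulrA.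
Qed.

End Action.

(* L is an Fq-algebra through iota, so iota is an Fq-algebra homomorphism. *)
Record drinfeld_module (Fq : finFieldType) (A : comAlgType Fq) (L : fieldType)
    (iota : {rmorphism A -> L}) := DrinfeldModule {
  drinfeld_fun :> {rmorphism A -> twisted (iota \o GRing.in_alg A)};
  drinfeld_const : forall a, (drinfeld_fun a : {poly L})`_0 = iota a;
  drinfeld_nonconst : exists a, forall c, (drinfeld_fun a : {poly L}) <> c%:P
}.

Definition drinfeld_points (Fq : finFieldType) (A : comAlgType Fq)
  (L : fieldType) (Lbar : closedFieldType) (iota : {rmorphism A -> L})
  (phi : drinfeld_module iota) (emb : {rmorphism L -> Lbar}) : Type := Lbar.

Definition adjoint_points (Fq : finFieldType) (A : comAlgType Fq)
  (L : fieldType) (Lbar : closedFieldType) (iota : {rmorphism A -> L})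
  (phi : drinfeld_module iota) (emb : {rmorphism L -> Lbar}) : Type := Lbar.

Section Points.
Variables (Fq : finFieldType) (A : comAlgType Fq) (L : fieldType).
Variables (Lbar : closedFieldType) (iota : {rmorphism A -> L}).
Variables (phi : drinfeld_module iota) (emb : {rmorphism L -> Lbar}).

Local Notation drinfeld_points := (drinfeld_points phi emb).
Local Notation adjoint_points := (adjoint_points phi emb).

HB.instance Definition _ := GRing.Zmodule.copy drinfeld_points Lbar.
HB.instance Definition _ := GRing.Zmodule.copy adjoint_points Lbar.

Definition drinfeld_scale (a : A) (z : drinfeld_points) : drinfeld_points :=
  twisted_act emb (phi a) z.
Definition adjoint_scale (a : A) (z : adjoint_points) : adjoint_points :=
  adjoint_act emb (phi a) z.

Fact drinfeld_scaleA a b z :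
  drinfeld_scale a (drinfeld_scale b z) = drinfeld_scale (a * b) z.
Proof. by rewrite /drinfeld_scale rmorphM twisted_actM. Qed.
Fact drinfeld_scale1 : left_id 1 drinfeld_scale.
Proof. by move=> z; rewrite /drinfeld_scale rmorph1 twisted_act1. Qed.
Fact drinfeld_scaleDr : right_distributive drinfeld_scale +%R.
Proof. by move=> a y z; apply: twisted_actDr. Qed.
Fact drinfeld_scaleDl z : {morph drinfeld_scale^~ z : a b / a + b}.
Proof. by move=> a b; rewrite /drinfeld_scale rmorphD twisted_actDl. Qed.

HB.instance Definition _ := GRing.Zmodule_isLmodule.Build A drinfeld_points
  drinfeld_scaleA drinfeld_scale1 drinfeld_scaleDr drinfeld_scaleDl.

Fact adjoint_scaleA a b z :
  adjoint_scale a (adjoint_scale b z) = adjoint_scale (a * b) z.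
Proof. by rewrite /adjoint_scale mulrC rmorphM adjoint_actM. Qed.
Fact adjoint_scale1 : left_id 1 adjoint_scale.
Proof. by move=> z; rewrite /adjoint_scale rmorph1 adjoint_act1. Qed.
Fact adjoint_scaleDr : right_distributive adjoint_scale +%R.
Proof. by move=> a y z; apply: adjoint_actDr. Qed.
Fact adjoint_scaleDl z : {morph adjoint_scale^~ z : a b / a + b}.
Proof. by move=> a b; rewrite /adjoint_scale rmorphD adjoint_actDl. Qed.

HB.instance Definition _ := GRing.Zmodule_isLmodule.Build A adjoint_points
  adjoint_scaleA adjoint_scale1 adjoint_scaleDr adjoint_scaleDl.

End Points.

Record galois_aut (L : fieldType) (Lbar : closedFieldType)
    (emb : {rmorphism L -> Lbar}) := GaloisAut {
  galois_fun :> {rmorphism Lbar -> Lbar};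
  galois_bij : bijective galois_fun;
  galois_fix : forall x, galois_fun (emb x) = emb x
}.

Section GaloisPoints.
Variables (Fq : finFieldType) (A : comAlgType Fq) (L : fieldType).
Variables (Lbar : closedFieldType) (iota : {rmorphism A -> L}).
Variables (phi : drinfeld_module iota) (emb : {rmorphism L -> Lbar}).
Variable sigma : galois_aut emb.

Definition galois_drinfeld (z : drinfeld_points phi emb) :
  drinfeld_points phi emb := sigma z.
Definition galois_adjoint (z : adjoint_points phi emb) :
  adjoint_points phi emb := sigma z.

Fact galois_drinfeld_linear : linear galois_drinfeld.
Proof.
move=> a y z; rewrite /galois_drinfeld [LHS]rmorphD; congr (_ + _).
rewrite [LHS]rmorph_sum; apply: eq_bigr => i _.
by rewrite rmorphM rmorphXn galois_fix.
Qed.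

Fact galois_adjoint_linear : linear galois_adjoint.
Proof.
move=> a y z; rewrite /galois_adjoint [LHS]rmorphD; congr (_ + _).
have sr n x : sigma (qroot Fq n x) = qroot Fq n (sigma x).
  apply/esym/(qroot_eq (iota \o GRing.in_alg A) emb).
  by rewrite -rmorphXn qrootK.
rewrite [LHS]rmorph_sum; apply: eq_bigr => i _.
by rewrite rmorphM !sr galois_fix.
Qed.

HB.instance Definition _ := GRing.isLinear.Build A _ _ _ galois_drinfeld
  galois_drinfeld_linear.
HB.instance Definition _ := GRing.isLinear.Build A _ _ _ galois_adjoint
  galois_adjoint_linear.

End GaloisPoints.

(* [quot_hom r e M] is Hom_R(K/A, M) for ring maps r : R -> A and e : A -> K,  *)
(* an element being given by its composite with K -> K/A.                      *)
Record quot_hom (R A : comNzRingType) (K : fieldType) (r : {rmorphism R -> A})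
    (e : {rmorphism A -> K}) (M : lmodType R) := QuotHom {
  quot_hom_fun :> K -> M;
  quot_homD : forall x y, quot_hom_fun (x + y) = quot_hom_fun x + quot_hom_fun y;
  quot_hom_int : forall c, quot_hom_fun (e c) = 0;
  quot_homZ : forall a x, quot_hom_fun (e (r a) * x) = a *: quot_hom_fun x
}.

Section QuotHom.
Variables (R A : comNzRingType) (K : fieldType) (r : {rmorphism R -> A}).
Variables (e : {rmorphism A -> K}) (M : lmodType R).
Local Notation H := (quot_hom r e M).

Lemma quot_hom_ext (f g : H) : f =1 g -> f = g.
Proof.
case: f g => [f f1 f2 f3] [g g1 g2 g3] /= /funext fg.
by subst g; congr QuotHom; apply: Prop_irrelevance.
Qed.

HB.instance Definition _ := gen_eqMixin H.
HB.instance Definition _ := gen_choiceMixin H.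

Definition quot_hom_zero : H.
Proof.
by exists (fun=> 0) => *; rewrite ?addr0 ?scaler0.
Defined.

Definition quot_hom_opp (f : H) : H.
Proof.
exists (fun x => - f x) => *.
- by rewrite quot_homD opprD.
- by rewrite quot_hom_int oppr0.
- by rewrite quot_homZ scalerN.
Defined.

Definition quot_hom_add (f g : H) : H.
Proof.
exists (fun x => f x + g x) => *.
- by rewrite !quot_homD addrACA.
- by rewrite !quot_hom_int addr0.
- by rewrite !quot_homZ scalerDr.
Defined.

Definition quot_hom_scale (c : A) (f : H) : H.
Proof.
exists (fun x => f (e c * x)) => *.
- by rewrite mulrDr quot_homD.
- by rewrite -rmorphM quot_hom_int.
- by rewrite mulrCA quot_homZ.
Defined.

Fact quot_hom_addA : associative quot_hom_add.
Proof. by move=> f g h; apply: quot_hom_ext => x; apply: addrA. Qed.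
Fact quot_hom_addC : commutative quot_hom_add.
Proof. by move=> f g; apply: quot_hom_ext => x; apply: addrC. Qed.
Fact quot_hom_add0 : left_id quot_hom_zero quot_hom_add.
Proof. by move=> f; apply: quot_hom_ext => x; apply: add0r. Qed.
Fact quot_hom_addN : left_inverse quot_hom_zero quot_hom_opp quot_hom_add.
Proof. by move=> f; apply: quot_hom_ext => x; apply: addNr. Qed.

HB.instance Definition _ := GRing.isZmodule.Build H
  quot_hom_addA quot_hom_addC quot_hom_add0 quot_hom_addN.

Fact quot_hom_scaleA c d f :
  quot_hom_scale c (quot_hom_scale d f) = quot_hom_scale (c * d) f.
Proof.
by apply: quot_hom_ext => x /=; rewrite [c * d]mulrC rmorphM -mulrA.
Qed.
Fact quot_hom_scale1 : left_id 1 quot_hom_scale.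
Proof. by move=> f; apply: quot_hom_ext => x /=; rewrite rmorph1 mul1r. Qed.
Fact quot_hom_scaleDr : right_distributive quot_hom_scale +%R.
Proof. by move=> c f g; apply: quot_hom_ext => x. Qed.
Fact quot_hom_scaleDl f : {morph quot_hom_scale^~ f : c d / c + d}.
Proof.
by move=> c d; apply: quot_hom_ext => x /=; rewrite rmorphD mulrDl quot_homD.
Qed.

HB.instance Definition _ := GRing.Zmodule_isLmodule.Build A H
  quot_hom_scaleA quot_hom_scale1 quot_hom_scaleDr quot_hom_scaleDl.

(* Pointwise convergence with M discrete. On a Tate module and on              *)
(* Hom_Fq(Kq/Aq, Fq) this is the profinite topology: the inverse limit over n  *)
(* of the finite groups Hom(m^-n/Aq, M), with m the maximal ideal of Aq.       *)
HB.instance Definition _ := Topological.copy H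
  (initial_topology (@quot_hom_fun _ _ _ r e M :
     H -> {ptws K -> discrete_topology M})).

Definition quot_hom_comp (u : {linear M -> M}) (f : H) : H.
Proof.
exists (fun x => u (f x)) => *.
- by rewrite quot_homD linearD.
- by rewrite quot_hom_int linear0.
- by rewrite quot_homZ linearZ.
Defined.

End QuotHom.

(* The value at 0 is a placeholder for +oo; [val_ge v n x] is v(x) >= n.       *)
Record discrete_valuation (F : fieldType) := DiscreteValuation {
  dval :> F -> int;
  dval0 : dval 0 = 0;
  dvalM : forall x y, x != 0 -> y != 0 -> dval (x * y) = dval x + dval y;
  dvalD : forall x y, x != 0 -> y != 0 -> x + y != 0 ->
    Num.min (dval x) (dval y) <= dval (x + y);
  dval_onto : exists2 x, x != 0 & dval x = 1
}.

Definition val_ge (F : fieldType) (v : discrete_valuation F) (n : int) (x : F) :=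
  (x == 0) || (n <= v x).

(* K is a finite extension of the field of rational functions Fq(t). *)
Definition function_field (Fq : finFieldType) (K : fieldType)
    (k : {rmorphism Fq -> K}) : Prop :=
  exists2 t : K, ~ algebraicOver k t &
  exists (n : nat) (b : 'I_n -> K), forall f : K,
  exists (g : {poly Fq}) (c : 'I_n -> {poly Fq}), g != 0 /\
    (map_poly k g).[t] * f = \sum_(i < n) (map_poly k (c i)).[t] * b i.

(* A nonsingular projective curve X over Fq is given by its function field K;  *)
(* its closed points are the normalized discrete valuations of K, which are    *)
(* all trivial on the finite field Fq. A function is regular on X - {oo} when  *)
(* it has no pole at any closed point other than oo.                           *)
Record regular_ring (Fq : finFieldType) (A : comAlgType Fq) (K : fieldType)
    (i : {rmorphism A -> K}) (oo : discrete_valuation K) : Prop := RegularRing {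
  regular_curve : function_field (i \o GRing.in_alg A);
  regular_inj : injective i;
  regularP : forall f : K, (exists a, i a = f) <->
    (forall P : discrete_valuation K, ~ (P =1 oo) -> val_ge P 0 f);
  regular_frac : forall f : K, exists a b, b != 0 /\ f = i a / i b
}.

Fixpoint ideal_power (A : comNzRingType) (I : {pred A}) (n : nat) (x : A) : Prop :=
  if n is m.+1 then
    exists s : seq (A * A), (forall ab, ab \in s -> ab.1 \in I /\ ideal_power I m ab.2)
      /\ x = \sum_(ab <- s) ab.1 * ab.2
  else True.

(* Kq is the completion of K for the valuation of the prime q, which on A is   *)
(* given by v(a) >= n iff a is in q^n; Aq is the completion of A, realized as  *)
(* the valuation ring of Kq.                                                   *)
Record completion_at (A : comNzRingType) (K : fieldType) (i : {rmorphism A -> K})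
    (q : {pred A}) (Aq : comNzRingType) (Kq : fieldType)
    (j : {rmorphism A -> Aq}) (k : {rmorphism K -> Kq})
    (e : {rmorphism Aq -> Kq}) (v : discrete_valuation Kq) : Prop := CompletionAt {
  completion_comm : forall a, k (i a) = e (j a);
  completion_val : forall a (n : nat), val_ge v n (k (i a)) <-> ideal_power q n a;
  completion_dense : forall (x : Kq) (n : nat), exists y, val_ge v n (x - k y);
  completion_complete : forall u : nat -> Kq,
    (forall n : nat, exists N, forall m m', (N <= m)%N -> (N <= m')%N ->
       val_ge v n (u m - u m')) ->
    exists l, forall n : nat, exists N, forall m, (N <= m)%N -> val_ge v n (u m - l);
  completion_int_inj : injective e;
  completion_int : forall x, (exists c, e c = x) <-> val_ge v 0 x;
  completion_int_dense : forall (c : Aq) (n : nat), exists a, val_ge v n (e (c - j a))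
}.

Notation tate phi emb j e := (quot_hom j e (drinfeld_points phi emb)).
Notation tate_adjoint phi emb j e := (quot_hom j e (adjoint_points phi emb)).
Notation residue_dual Fq A j e := (quot_hom (j \o GRing.in_alg A) e Fq^o).

Section TateGalois.
Variables (Fq : finFieldType) (A : comAlgType Fq) (L : fieldType).
Variables (Lbar : closedFieldType) (iota : {rmorphism A -> L}).
Variables (phi : drinfeld_module iota) (emb : {rmorphism L -> Lbar}).
Variables (Aq : comNzRingType) (Kq : fieldType) (j : {rmorphism A -> Aq}).
Variables (e : {rmorphism Aq -> Kq}) (sigma : galois_aut emb).

Definition tate_galois : tate phi emb j e -> tate phi emb j e :=
  quot_hom_comp (galois_drinfeld (phi := phi) sigma).
Definition tate_adjoint_galois :
    tate_adjoint phi emb j e -> tate_adjoint phi emb j e :=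
  quot_hom_comp (galois_adjoint (phi := phi) sigma).

End TateGalois.

(* The maps U -> Hom_S(V, W) and V -> Hom_S(U, W) induced by a bilinear B are  *)
(* bijective.                                                                  *)
Definition perfect_pairing (S : comNzRingType) (U V W : lmodType S)
    (B : U -> V -> W) : Prop :=
  (forall g : {linear V -> W}, exists! u, forall v, B u v = g v) /\
  (forall g : {linear U -> W}, exists! v, forall u, B u v = g u).

(* Main.v *)
(* Choose a in A with v_q(a) = 1 and iota(a) <> 0. A homomorphism from Kq/Aq  *)
(* to M is then a sequence of elements u_n of M[q^n] with a u_(n+1) = u_n. As *)
(* M[a^n] is finite for phi and for its adjoint, Nakayama's lemma gives an    *)
(* element of 1 + q^n that projects M[a^n] onto M[q^n].                       *)
(*   For f in L{tau}, y f(x) - f^*(y) x = P^q - P for an explicit biadditive  *)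
(* P(f; x, y), so P takes values in Fq on ker f x ker f^*. There it is        *)
(* nondegenerate, because a nonzero additive polynomial of degree at most     *)
(* q^(d-1) cannot vanish on the q^d elements of ker f. The cocycle identity   *)
(* P(fg; x, y) = P(f; g(x), y) + P(g; x, f^*(y)) makes the pairings for f =   *)
(* phi_(a^n) balanced over A and compatible in n. A linear map from one Tate  *)
(* module to the dual of Kq/Aq gives at each level n an Fq-form that vanishes *)
(* on the common kernel of the forms P(phi_(a^n); x, .), hence is one of      *)
(* them.                                                                      *)
(*   In the dual of Kq/Aq, a functional chi that does not vanish at the       *)
(* inverse of a is a generator: any other one is expanded digit by digit.     *)
(* This uses that A/q is finite, because K is finite over Fq(a): the elements *)
(* a^i u_l with i < n lie in an Fq-space of dimension N (C + n E) with E      *)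
(* independent of the u_l, so more than N E elements u_l are dependent over   *)
(* Fq[a].                                                                     *)

Require Import Defs.
From HB Require Import structures.
From mathcomp Require Import all_boot all_order all_algebra all_field.
From mathcomp Require Import all_classical topology.
From mathcomp Require Import ring.

Set Implicit Arguments.
Unset Strict Implicit.
Unset Printing Implicit Defensive.

Import Order.TTheory GRing.Theory Num.Theory.
Local Open Scope classical_set_scope.
Local Open Scope ring_scope.

(** * Linear algebra *)

Section LinearForms.
Variables (F : fieldType) (R : nzRingType) (k : {rmorphism F -> R}).
Variable V : lmodType R.

Definition linear_form (f : V -> F) :=
  forall c x y, f (k c *: x + y) = c * f x + f y.

Definition subspace (U : set V) :=
  U 0 /\ forall c x y, U x -> U y -> U (k c *: x + y).

Section LinearFormTheory.
Variable f : V -> F.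
Hypothesis f_lin : linear_form f.

Lemma linear_formD x y : f (x + y) = f x + f y.
Proof. by have := f_lin 1 x y; rewrite rmorph1 scale1r mul1r. Qed.

Lemma linear_form0 : f 0 = 0.
Proof. by apply: (addIr (f 0)); rewrite -linear_formD !add0r. Qed.

Lemma linear_formZ c x : f (k c *: x) = c * f x.
Proof. by rewrite -[k c *: x]addr0 f_lin linear_form0 addr0. Qed.

Lemma linear_formB x y : f (x - y) = f x - f y.
Proof. by apply: (addIr (f y)); rewrite -linear_formD !subrK. Qed.

Lemma linear_form_sum (I : Type) (r : seq I) (E : I -> V) :
  f (\sum_(i <- r) E i) = \sum_(i <- r) f (E i).
Proof. exact: (big_morph f linear_formD linear_form0). Qed.

End LinearFormTheory.

(* Induction on n: if h 0 does not vanish at x0, then                         *)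
(* x |-> x - (h 0 x / h 0 x0) x0 projects onto the kernel of h 0, and the     *)
(* other forms composed with this projection satisfy the hypothesis again.    *)
Lemma linear_form_span n (h : 'I_n -> V -> F) (g : V -> F) :
    (forall i, linear_form (h i)) -> linear_form g ->
    (forall x, (forall i, h i x = 0) -> g x = 0) ->
  exists c : 'I_n -> F, forall x, g x = \sum_i c i * h i x.
Proof.
elim: n h g => [|n IHn] h g h_lin g_lin ker_hg.
  by exists (fun=> 0) => x; rewrite big_ord0; apply: ker_hg => -[].
pose extend c0 (c : 'I_n -> F) i := oapp c c0 (unlift ord0 i).
have sum_extend c0 c x : \sum_i extend c0 c i * h i x =
    c0 * h ord0 x + \sum_i c i * h (lift ord0 i) x.
  rewrite big_ord_recl /extend unlift_none; congr (_ + _).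
  by apply: eq_bigr => i _; rewrite liftK.
have [[x0 hx0]|/forallNP h0] := pselect (exists x0, h ord0 x0 != 0); last first.
  have {}h0 x : h ord0 x = 0 by apply: contrapT => /eqP /h0.
  have [i|x hx|c cP] := IHn (fun i => h (lift ord0 i)) g _ g_lin.
  - exact: h_lin.
  - by apply: ker_hg => i; case: (unliftP ord0 i) => [i' ->|->].
  by exists (extend 0 c) => x; rewrite sum_extend mul0r add0r cP.
pose proj x := x - k (h ord0 x / h ord0 x0) *: x0.
have projE (f : V -> F) (f_lin : linear_form f) x :
    f (proj x) = f x - h ord0 x / h ord0 x0 * f x0.
  by rewrite linear_formB // linear_formZ.
have proj_lin (f : V -> F) (f_lin : linear_form f) : linear_form (f \o proj).
  by move=> c x y; rewrite /= !projE // f_lin h_lin; ring.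
have [i||x hx|c cP] := IHn (fun i => h (lift ord0 i) \o proj) (g \o proj).
- exact: proj_lin.
- exact: proj_lin.
- apply: ker_hg => i; case: (unliftP ord0 i) => [i' ->|->]; first exact: hx.
  by rewrite projE // divfK // subrr.
exists (extend ((g x0 - \sum_i c i * h (lift ord0 i) x0) / h ord0 x0) c) => x.
have := cP x; rewrite /= projE // => /eqP.
rewrite subr_eq sum_extend => /eqP ->.
under eq_bigr do rewrite projE // mulrBr mulrCA.
by rewrite sumrB -mulr_sumr; ring.
Qed.

Section SubspaceTheory.
Variable U : set V.
Hypothesis U_sub : subspace U.

Lemma subspaceZ c x : U x -> U (k c *: x).
Proof. by case: U_sub => U0 UP Ux; rewrite -[_ *: _]addr0; apply: UP. Qed.

Lemma subspaceB x y : U x -> U y -> U (x - y).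
Proof.
move=> Ux Uy; rewrite addrC -scaleN1r -(rmorphN1 k).
by case: U_sub => _; apply.
Qed.

End SubspaceTheory.

Lemma subspace_span1 U y :
  subspace U -> subspace [set z | exists c, U (z - k c *: y)].
Proof.
move=> [U0 UP]; split=> [|c x z [d Ux] [d' Uz]].
  by exists 0; rewrite rmorph0 scale0r subr0.
exists (c * d + d'); rewrite rmorphD rmorphM scalerDl -scalerA opprD addrACA.
by rewrite -scalerBr; apply: UP.
Qed.

Lemma maximal_subspace_avoiding S x0 : subspace S -> ~ S x0 ->
  exists U : set V, [/\ subspace U, S `<=` U, ~ U x0 &
    forall U', subspace U' -> U `<=` U' -> ~ U' x0 -> U' `<=` U].
Proof.
move=> S_sub Sx0.
(* The guard on X lets the empty union, hence the empty chain, qualify. *)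
pose avoiding X := X !=set0 -> [/\ subspace X, S `<=` X & ~ X x0].
have [|U [avU maxU]] := @Zorn_bigcup _ avoiding.
  move=> G avG totG [x1 [X1 GX1 X1x1]].
  have avoidG X x : G X -> X x -> [/\ subspace X, S `<=` X & ~ X x0].
    by move=> GX Xx; apply: avG => //; exists x.
  have [[X10 _] SX1 _] := avoidG _ _ GX1 X1x1.
  split=> [|x Sx|[X GX Xx0]]; last by have [_ _] := avoidG X x0 GX Xx0; apply.
    split=> [|c x y [X GX Xx] [Y GY Yy]]; first by exists X1.
    have [[_ XP] _ _] := avoidG X x GX Xx.
    have [[_ YP] _ _] := avoidG Y y GY Yy.
    have [XY|YX] := totG X Y GX GY.
      by exists Y => //; apply: YP => //; apply: XY.
    by exists X => //; apply: XP => //; apply: YX.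
  by exists X1 => //; apply: SX1.
have [U_sub SU Ux0] : [/\ subspace U, S `<=` U & ~ U x0].
  apply: avU; apply: contrapT => /nonemptyPn U0.
  apply: (maxU S); last by split.
  by rewrite U0; split=> // /(_ 0); apply; case: S_sub.
exists U; split=> // U' U'_sub UU' U'x0; apply: contrapT => U'U.
by apply: (maxU U') => // _; split=> //; apply: subset_trans UU'.
Qed.

Lemma hyperplane_avoiding S x0 : subspace S -> ~ S x0 -> exists U : set V,
  [/\ subspace U, S `<=` U, ~ U x0 & forall y, exists c, U (y - k c *: x0)].
Proof.
move=> S_sub Sx0.
have [U [U_sub SU Ux0 maxU]] := maximal_subspace_avoiding S_sub Sx0.
exists U; split=> // y; have [Uy|Uy] := pselect (U y).
  by exists 0; rewrite rmorph0 scale0r subr0.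
pose U' := [set z | exists c, U (z - k c *: y)].
have [[c Uc]|U'x0] := pselect (U' x0); last first.
  case: Uy; apply: (maxU U') => //; first exact: subspace_span1.
    by move=> z Uz; exists 0; rewrite rmorph0 scale0r subr0.
  by exists 1; rewrite rmorph1 scale1r subrr; case: U_sub.
have c0 : c != 0.
  by apply/eqP => c0; apply: Ux0; rewrite c0 rmorph0 scale0r subr0 in Uc.
exists c^-1; have := subspaceZ U_sub (- c^-1) Uc.
rewrite scalerBr scalerA -rmorphM mulNr mulVf // rmorphN1 scaleN1r opprK addrC.
by rewrite rmorphN scaleNr.
Qed.

Lemma separating_linear_form S x0 : subspace S -> ~ S x0 ->
  exists f, [/\ linear_form f, forall x, S x -> f x = 0 & f x0 = 1].
Proof.
move=> S_sub Sx0; have [U [U_sub SU Ux0 Uex]] := hyperplane_avoiding S_sub Sx0.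
have coord_uniq y c c' : U (y - k c *: x0) -> U (y - k c' *: x0) -> c = c'.
  move=> Uc Uc'; apply: contrapT => /eqP; rewrite eq_sym -subr_eq0 => cc'.
  apply: Ux0; have := subspaceZ U_sub (c' - c)^-1 (subspaceB U_sub Uc Uc').
  rewrite opprB [_ - _ + _]addrC subrKA -scalerBl -rmorphB scalerA -rmorphM.
  by rewrite mulVf // rmorph1 scale1r.
have [f fP] := choice Uex; exists f; split=> [c x y|x Sx|].
- apply: (coord_uniq _ _ _ (fP _)); rewrite rmorphD rmorphM scalerDl -scalerA.
  by rewrite opprD addrACA -scalerBr; case: U_sub => _; apply.
- by apply: (coord_uniq _ _ _ (fP _)); rewrite rmorph0 scale0r subr0; apply: SU.
- apply: (coord_uniq _ _ _ (fP _)).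
  by rewrite rmorph1 scale1r subrr; case: U_sub.
Qed.

End LinearForms.

Section Nakayama.
Variables (A : comNzRingType) (M : lmodType A).

Lemma det_annihilates n (B : 'M[A]_n) (y : 'I_n -> M) :
  (forall i, \sum_l B i l *: y l = 0) -> forall l, \det B *: y l = 0.
Proof.
move=> By l; have <- : \sum_m (\adj B *m B) l m *: y m = \det B *: y l.
  rewrite mul_adj_mx (bigD1 l) //= mxE eqxx mulr1n big1 ?addr0 // => m ml.
  by rewrite mxE eq_sym (negbTE ml) mulr0n scale0r.
under eq_bigr do rewrite mxE scaler_suml.
rewrite exchange_big big1 //= => i _.
under eq_bigr do rewrite -scalerA.
by rewrite -scaler_sumr By scaler0.
Qed.

Variable I : idealr A.

Let pi : {rmorphism A -> {ideal_quot I}} := \pi_({ideal_quot I})%qT.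

Let pi_eq x y : (pi x == pi y) = (x - y \in I).
Proof. exact: eqmodE. Qed.

Lemma det_1B_ideal n (E : 'M[A]_n) :
  (forall i l, E i l \in I) -> 1 - \det (1%:M - E) \in I.
Proof.
move=> EI; have piE : map_mx pi E = 0.
  apply/matrixP => i l; rewrite !mxE; apply/eqP.
  by rewrite -(rmorph0 pi) pi_eq subr0.
by rewrite -pi_eq -det_map_mx map_mxB piE subr0 map_mx1 det1 rmorph1.
Qed.

Lemma ideal_combination (ys : seq M) (s : seq (A * M)) :
    (forall z, z \in s -> z.1 \in I /\ z.2 \in ys) ->
  exists E : 'I_(size ys) -> A, (forall l, E l \in I) /\
    \sum_(z <- s) z.1 *: z.2 = \sum_l E l *: ys`_l.
Proof.
elim: s => [|[b m] s IHs] sP.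
  exists (fun=> 0); split=> [l|]; first exact: idealr0.
  by rewrite big_nil big1 // => l _; rewrite scale0r.
have [z zs|E [EI sE]] := IHs; first by apply: sP; rewrite inE zs orbT.
have [/= bI mys] := sP _ (mem_head _ _).
have m_lt : (index m ys < size ys)%N by rewrite index_mem.
exists (fun l => E l + (l == Ordinal m_lt)%:R * b); split=> [l|].
  by rewrite rpredD // idealMr.
rewrite big_cons sE (eq_bigr _ (fun l _ => scalerDl _ _ _)) big_split addrC /=.
congr (_ + _); rewrite (bigD1 (Ordinal m_lt)) //= eqxx mul1r nth_index //.
by rewrite big1 ?addr0 // => l /negbTE ->; rewrite mul0r scale0r.
Qed.

Lemma nakayama (ys : seq M) :
    (forall y, y \in ys -> exists s : seq (A * M),
       (forall z, z \in s -> z.1 \in I /\ z.2 \in ys) /\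
       y = \sum_(z <- s) z.1 *: z.2) ->
  exists2 x, x \in I & forall y, y \in ys -> (1 - x) *: y = 0.
Proof.
move=> ys_sub; have coord (i : 'I_(size ys)) : exists E : 'I_(size ys) -> A,
    (forall l, E l \in I) /\ ys`_i = \sum_l E l *: ys`_l.
  have [|s [sP ->]] := ys_sub ys`_i; first exact: mem_nth.
  exact: ideal_combination.
have [E EP] := choice coord; pose EM := \matrix_(i, l) E i l.
exists (1 - \det (1%:M - EM)).
  by apply: det_1B_ideal => i l; rewrite mxE; case: (EP i).
move=> _ /(nthP 0) [i i_lt <-]; rewrite opprB addrC subrK.
apply: (det_annihilates (y := fun l => ys`_l) _ (Ordinal i_lt)) => {i_lt}i.
under eq_bigr do rewrite !mxE scalerBl.
rewrite sumrB -(EP i).2 (bigD1 i) //= eqxx scale1r big1 ?addr0 ?subrr // => l.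
by rewrite eq_sym => /negbTE ->; rewrite scale0r.
Qed.

End Nakayama.

Section SpanModulo.
Variables (F : fieldType) (V : lmodType F) (P : V -> Prop).

Definition dependent_modulo m (u : 'I_m -> V) :=
  exists2 l : 'I_m -> F, (exists i, l i != 0) & P (\sum_i l i *: u i).

Definition spans_modulo n (u : 'I_n -> V) :=
  forall x, exists l : 'I_n -> F, P (x - \sum_i l i *: u i).

Hypothesis PZ : forall c x, P x -> P (c *: x).

(* A family of maximal length that is independent modulo P spans modulo P. *)
Lemma spans_modulo_exists m : (forall u : 'I_m -> V, dependent_modulo u) ->
  exists n (u : 'I_n -> V), spans_modulo u.
Proof.
elim: m => [|m IHm] dep; first by case: (dep (fun=> 0)) => l [[]].
have [/IHm//|/existsNP [u indep_u]] :=
  pselect (forall u : 'I_m -> V, dependent_modulo u).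
exists m, u => x.
have [l [i li]] := dep (fun i => oapp u x (unlift ord0 i)).
rewrite big_ord_recl unlift_none /=; under eq_bigr do rewrite liftK /=.
have [l0|l0 Pl] := eqVneq (l ord0) 0.
  rewrite l0 scale0r add0r => Pl; case: indep_u.
  exists (fun s => l (lift ord0 s)) => //.
  by case: (unliftP ord0 i) li => [s ->|->]; [exists s|rewrite l0 eqxx].
exists (fun s => - ((l ord0)^-1 * l (lift ord0 s))).
have := PZ (l ord0)^-1 Pl; rewrite scalerDr scalerA mulVf // scale1r.
congr (P (_ + _)); rewrite scaler_sumr -sumrN; apply: eq_bigr => s _.
by rewrite scalerA scaleNr opprK.
Qed.

End SpanModulo.

Lemma dependent_of_span (F : fieldType) (R : nzRingType)
    (k : {rmorphism F -> R}) (X Y : finType) (x : X -> R) (y : Y -> R)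
    (C : X -> Y -> F) :
    (#|Y| < #|X|)%N -> (forall i, x i = \sum_l k (C i l) * y l) ->
  exists2 c : X -> F, (exists i, c i != 0) & \sum_i k (c i) * x i = 0.
Proof.
move=> YX xE.
pose CM := \matrix_(r < #|X|, s < #|Y|) C (enum_val r) (enum_val s).
have /rowV0Pn [c /sub_kermxP cC c0] : kermx CM != 0.
  by rewrite kermx_eq0 /row_free neq_ltn (leq_ltn_trans (rank_leq_col _)).
exists (fun i => c 0 (enum_rank i)).
  by have /rV0Pn [r cr] := c0; exists (enum_val r); rewrite enum_valK.
under eq_bigr do rewrite xE mulr_sumr.
rewrite exchange_big big1 //= => l _.
under eq_bigr do rewrite mulrA -rmorphM.
rewrite -mulr_suml -rmorph_sum (reindex _ (onW_bij _ (@enum_val_bij X))) /=.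
have /matrixP /(_ 0 (enum_rank l)) := cC; rewrite !mxE => cCl.
rewrite [X in k X](_ : _ = 0) ?rmorph0 ?mul0r // -[RHS]cCl.
by apply: eq_bigr => r _; rewrite !mxE enum_valK enum_rankK.
Qed.

(** * Linear dependence over F[a] *)

Definition poly_dependent (F : fieldType) (R : nzRingType)
    (k : {rmorphism F -> R}) (a : R) m (u : 'I_m -> R) :=
  exists2 P : 'I_m -> {poly F}, (exists l, P l != 0) &
    \sum_l (map_poly k (P l)).[a] * u l = 0.

(* Divide the relation by the largest power of X and reduce it modulo a. *)
Lemma poly_dependent_modulo (F : fieldType) (R : comNzRingType)
    (k : {rmorphism F -> R}) (a : R) m (u : 'I_m -> R) :
    GRing.lreg a -> poly_dependent k a u ->
  exists2 c : 'I_m -> F, (exists l, c l != 0) &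
    exists d, \sum_l k (c l) * u l = a * d.
Proof.
move=> a_reg [P P0 relP].
have [n Pn] : exists n, forall l, (size (P l) <= n)%N.
  by exists (\max_l size (P l)) => l; apply: leq_bigmax.
elim: n => [|n IHn] in P P0 relP Pn *.
  by case: P0 => l; rewrite -size_poly_leq0 Pn.
pose Q l := drop_poly 1 (P l).
have PE l : (map_poly k (P l)).[a] = k (P l)`_0 + a * (map_poly k (Q l)).[a].
  rewrite -[in LHS](poly_take_drop 1 (P l)) rmorphD rmorphM /= map_polyXn.
  rewrite hornerD hornerM_comm ?hornerXn ?expr1; last exact: mulrC.
  rewrite [a * _]mulrC /take_poly poly_def big_ord1 expr0 alg_polyC map_polyC.
  by rewrite hornerC.
have {relP} : \sum_l k (P l)`_0 * u l +
    a * \sum_l (map_poly k (Q l)).[a] * u l = 0.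
  rewrite -[RHS]relP mulr_sumr -big_split; apply: eq_bigr => l _.
  by rewrite PE mulrDl mulrA.
have [[l Pl]|/forallNP P00] := pselect (exists l, (P l)`_0 != 0).
  move=> /eqP; rewrite addr_eq0 => /eqP relP.
  exists (fun l => (P l)`_0); first by exists l.
  by exists (- \sum_l (map_poly k (Q l)).[a] * u l); rewrite mulrN.
have {}P00 l : (P l)`_0 = 0 by apply: contrapT => /eqP /P00.
rewrite big1 ?add0r => [|l _]; last by rewrite P00 rmorph0 mul0r.
rewrite -[X in _ = X](mulr0 a) => /a_reg relQ; apply: (IHn Q) => // [|l].
  case: P0 => l Pl; exists l; apply: contra_neq Pl => Ql.
  rewrite -(poly_take_drop 1 (P l)) -/(Q l) Ql mul0r addr0 /take_poly poly_def.
  by rewrite big_ord1 P00 scale0r.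
by rewrite size_drop_poly leq_subLR add1n.
Qed.

Section RationalSpan.
Variables (F K : fieldType) (k : {rmorphism F -> K}).
Variables (t : K) (N : nat) (b : 'I_N -> K).
Hypothesis t_trans : ~ algebraicOver k t.
Hypothesis b_span : forall x : K, exists (g : {poly F}) (c : 'I_N -> {poly F}),
  g != 0 /\ (map_poly k g).[t] * x = \sum_(i < N) (map_poly k (c i)).[t] * b i.

Local Notation ev p := (map_poly k p).[t].

Let ev_neq0 p : p != 0 -> ev p != 0.
Proof. by move=> p0; apply/negP => evp; apply: t_trans; exists p. Qed.

Definition bounded_span n x := exists2 c : 'I_N -> {poly F},
  forall l, (size (c l) <= n)%N & x = \sum_l ev (c l) * b l.

Lemma bounded_span0 n : bounded_span n 0.
Proof.
exists (fun=> 0) => [l|]; first by rewrite size_poly0.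
by rewrite big1 // => l _; rewrite rmorph0 horner0 mul0r.
Qed.

Lemma bounded_spanD n x y :
  bounded_span n x -> bounded_span n y -> bounded_span n (x + y).
Proof.
move=> [c sc ->] [d sd ->]; exists (fun l => c l + d l) => [l|].
  by apply: leq_trans (size_polyD _ _) _; rewrite geq_max sc sd.
by rewrite -big_split; apply: eq_bigr => l _; rewrite rmorphD hornerD mulrDl.
Qed.

Lemma bounded_spanW n m x : (n <= m)%N -> bounded_span n x -> bounded_span m x.
Proof. by move=> nm [c sc ->]; exists c => // l; apply: leq_trans nm. Qed.

Lemma bounded_spanM n m (p : {poly F}) x :
  (size p <= m)%N -> bounded_span n x -> bounded_span (n + m) (ev p * x).
Proof.
move=> pm [c sc ->]; exists (fun l => p * c l) => [l|].
  apply: leq_trans (size_polyMleq _ _) (leq_trans (leq_pred _) _).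
  by rewrite addnC leq_add.
by rewrite mulr_sumr; apply: eq_bigr => l _; rewrite rmorphM hornerM mulrA.
Qed.

Lemma bounded_span_exp c E :
    (forall n x, bounded_span n x -> bounded_span (n + E) (c * x)) ->
  forall r n x, bounded_span n x -> bounded_span (n + r * E) (c ^+ r * x).
Proof.
move=> cE r n x Vx; elim: r => [|r IHr]; first by rewrite mul1r addn0.
by rewrite exprS -mulrA mulSn addnCA addnC; apply: cE.
Qed.

Lemma bounded_span_dependent (X : finType) (x : X -> K) n :
    (N * n < #|X|)%N -> (forall i, bounded_span n (x i)) ->
  exists2 c : X -> F, (exists i, c i != 0) & \sum_i k (c i) * x i = 0.
Proof.
move=> NnX xV; have /choice [C CP] : forall i, exists C : 'I_N -> {poly F},
    (forall l, (size (C l) <= n)%N) /\ x i = \sum_l ev (C l) * b l.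
  by move=> i; have [C] := xV i; exists C.
apply: (@dependent_of_span _ _ _ _ _ _
  (fun lr : 'I_N * 'I_n => t ^+ lr.2 * b lr.1) (fun i lr => (C i lr.1)`_lr.2)).
  by rewrite card_prod !card_ord.
move=> i; have [sC ->] := CP i.
rewrite -(pair_bigA _ (fun l (r : 'I_n) => k (C i l)`_r * (t ^+ r * b l))) /=.
apply: eq_bigr => l _; rewrite (@horner_coef_wide _ n) ?size_map_poly //.
by rewrite mulr_suml; apply: eq_bigr => r _; rewrite coef_map mulrA.
Qed.

Lemma common_denominator (s : seq K) : exists g n, g != 0 /\
  forall x, x \in s -> bounded_span n (ev g * x).
Proof.
elim: s => [|x s [g [n [g0 gP]]]]; first by exists 1, 0%N; rewrite oner_neq0.
have [h [c [h0 hP]]] := b_span x.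
have Vx : bounded_span (\max_l size (c l)) (ev h * x).
  by exists c => // l; apply: leq_bigmax.
exists (g * h), (n + size h + (\max_l size (c l) + size g))%N.
split=> [|y]; first by rewrite mulf_neq0.
rewrite inE rmorphM hornerM => /predU1P[->|/gP Vy].
  by rewrite -mulrA; apply: bounded_spanW (leq_addl _ _) (bounded_spanM _ Vx).
rewrite [ev g * _]mulrC -mulrA.
exact: bounded_spanW (leq_addr _ _) (bounded_spanM _ Vy).
Qed.

Lemma multiplication_denominator (a : K) : exists g E, g != 0 /\ forall n x,
  bounded_span n x ->
  bounded_span (n + E) (ev g * x) /\ bounded_span (n + E) (ev g * a * x).
Proof.
have [g [E [g0 gP]]] := common_denominator [seq a * b l | l : 'I_N].
exists g, (E + size g)%N; split=> // n x Vx; split.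
  by apply: bounded_spanM Vx; apply: leq_addl.
have [c sc ->] := Vx; rewrite mulr_sumr.
elim/big_ind: _ => [|y z|l _]; [exact: bounded_span0|exact: bounded_spanD|].
have -> : ev g * a * (ev (c l) * b l) = ev (c l) * (ev g * (a * b l)) by ring.
rewrite addnC; apply: bounded_spanM (sc l) _.
by apply: bounded_spanW (leq_addr _ _) (gP _ _); apply: map_f; rewrite mem_enum.
Qed.

(* After clearing denominators, the elements a^i u_l with i < n lie in a      *)
(* space of dimension N (C + n E), with E independent of u, so m = N E + 1    *)
(* elements u_l suffice.                                                      *)
Lemma rational_span_poly_dependent (a : K) :
  exists m, forall u : 'I_m -> K, poly_dependent k a u.
Proof.
have [g [E [g0 gP]]] := multiplication_denominator a.
exists (N * E).+1 => u.
have [h [C [h0 hP]]] := common_denominator [seq u l | l : 'I_(N * E).+1].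
pose n := (N * C).+1; pose z := ev g ^+ n * ev h.
have z0 : z != 0 by rewrite mulf_neq0 ?expf_neq0 ?ev_neq0.
have Vu (li : 'I_(N * E).+1 * 'I_n) :
    bounded_span (C + n * E) (z * (a ^+ li.2 * u li.1)).
  case: li => l i /=; have i_le : (i <= n)%N by apply: ltnW.
  have Vl : bounded_span C (ev h * u l) by apply/hP/map_f; rewrite mem_enum.
  have -> : z * (a ^+ i * u l) =
      ev g ^+ (n - i) * ((ev g * a) ^+ i * (ev h * u l)).
    have gn : ev g ^+ n = ev g ^+ (n - i) * ev g ^+ i by rewrite -exprD subnK.
    by rewrite /z gn exprMn; ring.
  have -> : (C + n * E = C + i * E + (n - i) * E)%N.
    by rewrite -addnA -mulnDl subnKC.
  apply: bounded_span_exp => [r x /gP []//|].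
  by apply: bounded_span_exp Vl => r x /gP [].
have [|c [[l i] c0] cP] := bounded_span_dependent _ Vu.
  by rewrite card_prod !card_ord mulnDr mulSn mulnCA [(_ * n)%N]mulnC ltn_add2r.
exists (fun l => \poly_(i < n) c (l, inord i)).
  exists l; apply/eqP => /polyP /(_ i).
  by rewrite coef_poly ltn_ord inord_val coef0; apply/eqP.
apply: (mulfI z0); rewrite mulr0 -[RHS]cP mulr_sumr.
rewrite [RHS](eq_bigr (fun li =>
  k (c (li.1, li.2)) * (z * (a ^+ li.2 * u li.1)))); last by case.
rewrite -(pair_bigA _ (fun l (i : 'I_n) =>
  k (c (l, i)) * (z * (a ^+ i * u l)))) /=.
apply: eq_bigr => s _; rewrite (@horner_coef_wide _ n); last first.
  by apply: leq_trans (size_poly _ _) (size_poly _ _).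
rewrite mulr_suml mulr_sumr; apply: eq_bigr => r _.
by rewrite coef_map coef_poly ltn_ord inord_val; ring.
Qed.

End RationalSpan.

Lemma function_field_poly_dependent (Fq : finFieldType) (K : fieldType)
    (k : {rmorphism Fq -> K}) (a : K) : function_field k ->
  exists m, forall u : 'I_m -> K, poly_dependent k a u.
Proof.
move=> [t t_trans [N [b b_span]]].
exact: rational_span_poly_dependent t_trans b_span a.
Qed.

(** * Additive polynomials *)

Lemma natr_card_eq0 (F : finNzRingType) : #|F|%:R = 0 :> F.
Proof.
apply: (addrI (\sum_(x : F) x)); rewrite addr0 [RHS](reindex_inj (addIr 1)).
by rewrite big_split sumr_const.
Qed.

Lemma frob_fixed_image (Fq : finFieldType) (K : fieldType)
    (k : {rmorphism Fq -> K}) (z : K) : z ^+ #|Fq| = z -> exists l, k l = z.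
Proof.
move=> zq; have : root (map_poly k ('X^#|Fq| - 'X)) z.
  by rewrite rootE rmorphB /= map_polyXn map_polyX !hornerE zq subrr.
rewrite (finField_genPoly Fq) rmorph_prod /=.
under eq_bigr do rewrite rmorphB /= map_polyX map_polyC /=.
rewrite rootE horner_prod => /prodf_eq0 [l _].
by rewrite hornerXsubC subr_eq0 => /eqP ->; exists l.
Qed.

Lemma expf_card_exp (Fq : finFieldType) (l : Fq) n : l ^+ (#|Fq| ^ n) = l.
Proof. by elim: n => [|n IH]; rewrite ?expr1 // expnSr exprM IH expf_card. Qed.

Lemma coef_sum_monomials (R : nzRingType) (I : finType) (P : pred I)
    (c : I -> R) (n : I -> nat) i0 :
  P i0 -> (forall i, P i -> n i = n i0 -> i = i0) ->
  (\sum_(i | P i) c i *: 'X^(n i))`_(n i0) = c i0.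
Proof.
move=> Pi0 n_inj; rewrite coef_sum (bigD1 i0) //= coefZ coefXn eqxx mulr1.
rewrite big1 ?addr0 // => i /andP[Pi ii0]; rewrite coefZ coefXn.
case: eqP => [/esym/(n_inj i Pi) ii|_]; last exact: mulr0.
by rewrite ii eqxx in ii0.
Qed.

Section AdditivePolynomials.
Variables (Fq : finFieldType) (L : closedFieldType) (k : {rmorphism Fq -> L}).
Local Notation q := #|Fq|.

Let q_gt1 : (1 < q)%N. Proof. exact: finNzRing_gt1. Qed.

Variables (d : nat) (c : nat -> L).

Definition additive_poly : {poly L} := \sum_(i < d.+1) c i *: 'X^(q ^ i).
Local Notation G := additive_poly.

Lemma horner_additive_poly z : G.[z] = \sum_(i < d.+1) c i * z ^+ (q ^ i).
Proof.
by rewrite horner_sum; apply: eq_bigr => i _; rewrite hornerZ hornerXn.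
Qed.

Hypotheses (c0 : c 0%N != 0) (cd : c d != 0).

Lemma size_additive_poly : size G = (q ^ d).+1.
Proof.
rewrite /additive_poly big_ord_recr /= addrC.
rewrite size_polyDl ?size_scale ?size_polyXn //.
apply: leq_ltn_trans (size_sum _ _ _) _; rewrite ltnS; apply/bigmax_leqP => i _.
by apply: leq_trans (size_scale_leq _ _) _; rewrite size_polyXn ltn_exp2l.
Qed.

Lemma additive_poly_surj w : exists z, G.[z] = w.
Proof.
have : size (G - w%:P) != 1%N.
  have qd_gt0 : (0 < q ^ d)%N by rewrite expn_gt0 ltnW.
  rewrite size_polyDl ?size_additive_poly; first by rewrite eqSS -lt0n.
  by rewrite size_polyN (leq_ltn_trans (size_polyC_leq1 _)).
case/closed_rootP => z; rewrite rootE hornerD hornerN hornerC subr_eq0 => /eqP.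
by exists z.
Qed.

Lemma deriv_additive_poly : G^`() = (c 0%N)%:P.
Proof.
have q0 : q%:R = 0 :> {poly L}.
  by rewrite -(rmorph_nat (polyC \o k)) natr_card_eq0 rmorph0.
rewrite /additive_poly big_ord_recl derivD derivZ expn0 expr1 derivX alg_polyC.
rewrite (linear_sum (@deriv L)) big1 ?addr0 // => i _.
by rewrite linearZ /= derivXn expnS -mulr_natl natrM q0 !mul0r scaler0.
Qed.

Lemma additive_poly_roots : exists s : seq L,
  [/\ uniq s, size s = (q ^ d)%N & forall z, (z \in s) = (G.[z] == 0)].
Proof.
have [s [l l0 sE]] : exists s, exists2 l, l != 0 &
    G = l *: \prod_(z <- s) ('X - z%:P).
  have [s sE] := closed_field_poly_normal G; exists s, (lead_coef G) => //.
  by rewrite lead_coef_eq0 -size_poly_eq0 size_additive_poly.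
have sP z : (z \in s) = (G.[z] == 0).
  by rewrite -[RHS]/(root G z) sE rootZ // root_prod_XsubC.
exists s; split=> //; last first.
  apply: succn_inj; rewrite -size_additive_poly sE size_scale //.
  by rewrite size_prod_XsubC.
have : separable_poly G.
  by rewrite unlock deriv_additive_poly -alg_polyC coprimepZr // coprimep1.
rewrite -separable_prod_XsubC sE !unlock derivZ coprimepZl //.
by rewrite coprimepZr.
Qed.

Lemma additive_poly_isolated_coef (I : finType) (P : pred I) (s : I -> L)
    (x : I -> nat) i0 :
    P i0 -> (forall i, P i -> (x i < d)%N) ->
    (forall i, P i -> x i = x i0 -> i = i0) ->
    (forall z, G.[z] = 0 -> \sum_(i | P i) s i * z ^+ (q ^ x i) = 0) ->
  s i0 = 0.
Proof.
move=> Pi0 x_lt x_inj sum0; pose H := \sum_(i | P i) s i *: 'X^(q ^ x i).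
have [r [ur sr rP]] := additive_poly_roots.
suff H0 : H = 0.
  have <- : H`_(q ^ x i0) = s i0; last by rewrite H0 coef0.
  apply: (coef_sum_monomials s (n := fun i => q ^ x i)%N i0 Pi0) => i Pi /eqP.
  by rewrite eqn_exp2l // => /eqP; apply: x_inj.
have : (size H <= q ^ d)%N.
  apply: leq_trans (size_sum _ _ _) _; apply/bigmax_leqP => i /x_lt x_i_lt.
  by apply: leq_trans (size_scale_leq _ _) _; rewrite size_polyXn ltn_exp2l.
apply: contraTeq => H0; rewrite -ltnNge -sr; apply: max_poly_roots => //.
apply/allP => z; rewrite rP => /eqP /sum0; rewrite rootE horner_sum => {2}<-.
by apply/eqP/eq_bigr => i _; rewrite hornerZ hornerXn.
Qed.

End AdditivePolynomials.

(** * Green's identity *)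

Section Green.
Variables (Fq : finFieldType) (L : fieldType) (Lbar : closedFieldType).
Variables (k : {rmorphism Fq -> L}) (emb : {rmorphism L -> Lbar}).
Local Notation q := #|Fq|.
Local Notation tw := (twisted k).
Local Notation kbar := (emb \o k).

Definition frob_trace n (y : Lbar) := \sum_(l < n) y ^+ (q ^ l).

Let frobqD (x y : Lbar) : (x + y) ^+ q = x ^+ q + y ^+ q.
Proof. by have := frobD kbar 1 x y; rewrite expn1. Qed.

Lemma frob_traceD n x y :
  frob_trace n (x + y) = frob_trace n x + frob_trace n y.
Proof. by rewrite -big_split; apply: eq_bigr => l _; rewrite (frobD kbar). Qed.

Lemma frob_traceZ n (l : Fq) y :
  frob_trace n (kbar l * y) = kbar l * frob_trace n y.
Proof.
rewrite mulr_sumr; apply: eq_bigr => i _.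
by rewrite exprMn -rmorphXn expf_card_exp.
Qed.

Lemma frob_trace_frob n y :
  frob_trace n y ^+ q = frob_trace n y - y + y ^+ (q ^ n).
Proof.
elim: n => [|n IH].
  have := frob0 Fq Lbar 1; rewrite expn1 /frob_trace !big_ord0 => ->.
  by rewrite expr1 sub0r addNr.
rewrite /frob_trace big_ord_recr /= -/(frob_trace n y) frobqD IH.
by rewrite -exprM -expnSr; ring.
Qed.

Lemma frob_trace_add m n y :
  frob_trace (m + n) y = frob_trace n y + frob_trace m (y ^+ (q ^ n)).
Proof.
elim: m => [|m IH]; first by rewrite /frob_trace big_ord0 addr0.
rewrite addSn /frob_trace !big_ord_recr /= -!/(frob_trace _ _) IH -addrA.
by rewrite -exprM -expnD [(n + m)%N]addnC.
Qed.

Lemma qroot_scalar n (l : Fq) : qroot Fq n (kbar l) = kbar l.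
Proof. by apply: (qroot_eq k emb); rewrite -rmorphXn expf_card_exp. Qed.

(* The boundary term of Green's identity y f(x) - f^*(y) x = P^q - P. *)
Definition green (f : tw) (x y : Lbar) : Lbar :=
  \sum_(i < size (f : {poly L})) frob_trace i
    (qroot Fq i (emb (f : {poly L})`_i) * qroot Fq i y * x).

Let greenF x y i b := frob_trace i (qroot Fq i (emb b) * qroot Fq i y * x).
Let greenFD x y i b c : greenF x y i (b + c) = greenF x y i b + greenF x y i c.
Proof. by rewrite /greenF rmorphD (qrootD k emb) !mulrDl frob_traceD. Qed.

Lemma greenDf f g x y : green (f + g) x y = green f x y + green g x y.
Proof. exact: (sum_coefD (greenFD x y)). Qed.

Lemma green0f x y : green 0 x y = 0.
Proof. exact: (sum_coef0 (greenF x y)). Qed.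

Lemma greenZX b n x y : green (b *: 'X^n : {poly L}) x y =
  frob_trace n (qroot Fq n (emb b) * qroot Fq n y * x).
Proof. exact: (sum_coefZX (greenFD x y)). Qed.

Lemma greenDl f x x' y : green f (x + x') y = green f x y + green f x' y.
Proof.
by rewrite -big_split; apply: eq_bigr => i _; rewrite mulrDr frob_traceD.
Qed.

Lemma greenDr f x y y' : green f x (y + y') = green f x y + green f x y'.
Proof.
rewrite -big_split; apply: eq_bigr => i _.
by rewrite (qrootD k emb) mulrDr mulrDl frob_traceD.
Qed.

Lemma green0l f y : green f 0 y = 0.
Proof. by apply: (addIr (green f 0 y)); rewrite -greenDl !add0r. Qed.

Lemma green0r f x : green f x 0 = 0.
Proof. by apply: (addIr (green f x 0)); rewrite -greenDr !add0r. Qed.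

Lemma greenZl f (l : Fq) x y : green f (kbar l * x) y = kbar l * green f x y.
Proof.
by rewrite mulr_sumr; apply: eq_bigr => i _; rewrite mulrCA frob_traceZ.
Qed.

Lemma greenZr f (l : Fq) x y : green f x (kbar l * y) = kbar l * green f x y.
Proof.
rewrite -greenZl; apply: eq_bigr => i _; congr (frob_trace _ _).
by rewrite (qrootM k emb) qroot_scalar; ring.
Qed.

Lemma green_identity f x y :
  green f x y ^+ q - green f x y =
  y * twisted_act emb f x - adjoint_act emb f y * x.
Proof.
elim/poly_add_ind: f => [|f g IHf IHg|b n].
- have := frob0 Fq Lbar 1; rewrite expn1 green0f => ->.
  by rewrite twisted_act0 adjoint_act0 mulr0 mul0r.
- rewrite greenDf twisted_actDl (adjoint_actDl emb) frobqD.
  by rewrite opprD addrACA IHf IHg; ring.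
rewrite greenZX twisted_actZX adjoint_actZX frob_trace_frob !exprMn !qrootK.
by ring.
Qed.

Lemma green_ker_in_Fq f x y :
  twisted_act emb f x = 0 -> adjoint_act emb f y = 0 ->
  exists l, kbar l = green f x y.
Proof.
move=> fx fy; apply: frob_fixed_image; apply/eqP; rewrite -subr_eq0.
by rewrite green_identity fx fy mulr0 mul0r subrr.
Qed.

Lemma greenM f g x y : green (f * g) x y =
  green f (twisted_act emb g x) y + green g x (adjoint_act emb f y).
Proof.
elim/poly_add_ind: f => [|f f' IHf IHf'|b n].
- by rewrite mul0r !green0f adjoint_act0 green0r addr0.
- by rewrite mulrDl !greenDf IHf IHf' adjoint_actDl greenDr addrACA.
elim/poly_add_ind: g => [|g g' IHg IHg'|b' m].
- by rewrite mulr0 !green0f twisted_act0 green0l addr0.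
- by rewrite mulrDr !greenDf IHg IHg' twisted_actDl greenDl addrACA.
rewrite [_ * _](twisted_mulX k) !greenZX frob_trace_add addrC.
rewrite twisted_actZX adjoint_actZX rmorphM rmorphXn !(qrootM k emb).
rewrite !(qroot_qroot k emb) (qrootX k emb).
congr (frob_trace _ _ + frob_trace _ _); last by ring.
by rewrite !exprMn -!(qroot_qroot k emb) !qrootK; ring.
Qed.

Lemma rmorph_qroot (sigma : {rmorphism Lbar -> Lbar}) n z :
  sigma (qroot Fq n z) = qroot Fq n (sigma z).
Proof. by apply/esym/(qroot_eq k emb); rewrite -rmorphXn qrootK. Qed.

Lemma green_galois (sigma : galois_aut emb) f x y :
  green f (sigma x) (sigma y) = sigma (green f x y).
Proof.
rewrite [RHS]rmorph_sum; apply: eq_bigr => i _.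
rewrite [RHS]rmorph_sum; apply: eq_bigr => l _.
rewrite [RHS]rmorphXn 2![in RHS](rmorphM (galois_fun sigma)).
by rewrite !(rmorph_qroot (galois_fun sigma)) galois_fix.
Qed.

End Green.

Section TwistedKernels.
Variables (Fq : finFieldType) (L : fieldType) (Lbar : closedFieldType).
Variables (k : {rmorphism Fq -> L}) (emb : {rmorphism L -> Lbar}).
Local Notation q := #|Fq|.
Local Notation tw := (twisted k).
Local Notation kbar := (emb \o k).

Variable f : tw.
Hypothesis f0 : (f : {poly L})`_0 != 0.
Let d := (size (f : {poly L})).-1.

Let size_f : size (f : {poly L}) = d.+1.
Proof.
rewrite /d prednK // lt0n size_poly_eq0; apply: contraNneq f0 => ->.
by rewrite coef0.
Qed.

Let fd : (f : {poly L})`_d != 0.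
Proof.
rewrite -[_`_d]/(lead_coef (f : {poly L})) lead_coef_eq0.
by rewrite -size_poly_eq0 size_f.
Qed.

Let c i := emb (f : {poly L})`_i.
Let rho i := qroot Fq i (c i).
Let c_adj i := rho (d - i)%N.

Let twisted_actE z : twisted_act emb f z = (additive_poly Fq d c).[z].
Proof. by rewrite horner_additive_poly /twisted_act size_f. Qed.

Let qroot_exp i n (z : Lbar) :
  (i <= n)%N -> qroot Fq i (z ^+ (q ^ n)) = z ^+ (q ^ (n - i)).
Proof.
by move=> le_in; apply: (qroot_eq k emb); rewrite -exprM -expnD subnK.
Qed.

(* The adjoint of f becomes an additive polynomial in the q^d-th root of its  *)
(* argument.                                                                  *)
Let adjoint_actE z :
  adjoint_act emb f (z ^+ (q ^ d)) = (additive_poly Fq d c_adj).[z].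
Proof.
rewrite horner_additive_poly /adjoint_act size_f (reindex_inj rev_ord_inj) /=.
apply: eq_bigr => i _; rewrite subSS /c_adj /rho; congr (_ * _).
by rewrite qroot_exp ?leq_subr // subKn // -ltnS.
Qed.

Let rho_neq0 i : (f : {poly L})`_i != 0 -> rho i != 0.
Proof.
apply: contra_neq => rho0; apply: (fmorph_inj emb); rewrite rmorph0.
by rewrite -[LHS](qrootK Fq i) -/(c i) -/(rho i) rho0 (frob0 Fq Lbar).
Qed.

Let c0 : c 0 != 0. Proof. by rewrite fmorph_eq0. Qed.
Let cd : c d != 0. Proof. by rewrite fmorph_eq0. Qed.
Let c_adj0 : c_adj 0 != 0. Proof. by rewrite /c_adj subn0 rho_neq0. Qed.
Let c_adjd : c_adj d != 0. Proof. by rewrite /c_adj subnn rho_neq0. Qed.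

Lemma twisted_act_surj w : exists z, twisted_act emb f z = w.
Proof.
have [z zw] := additive_poly_surj Fq cd w.
by exists z; rewrite twisted_actE.
Qed.

Lemma adjoint_act_surj w : exists z, adjoint_act emb f z = w.
Proof.
have [z zw] := additive_poly_surj Fq c_adjd w.
by exists (z ^+ (q ^ d)); rewrite adjoint_actE.
Qed.

Lemma twisted_ker_finite : finite_set [set z | twisted_act emb f z = 0].
Proof.
have [s [_ _ sP]] := additive_poly_roots kbar c0 cd.
apply/finite_seqP; exists s; apply/seteqP.
by split=> z /=; rewrite twisted_actE sP => /eqP.
Qed.

Lemma adjoint_ker_finite : finite_set [set z | adjoint_act emb f z = 0].
Proof.
have [s [_ _ sP]] := additive_poly_roots kbar c_adj0 c_adjd.
apply: (@sub_finite_set _ _ [set` [seq z ^+ (q ^ d) | z <- s]]) => [z /= fz|].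
  rewrite -(qrootK Fq d z); apply: map_f.
  by rewrite sP -adjoint_actE qrootK fz.
exact: finite_seq.
Qed.

Let green_pairs x y : green emb f x y =
  \sum_(p : 'I_d.+1 * 'I_d | (p.2 < p.1)%N)
    (rho p.1 * qroot Fq p.1 y * x) ^+ (q ^ p.2).
Proof.
pose F (i l : nat) := (rho i * qroot Fq i y * x) ^+ (q ^ l).
transitivity (\sum_(i < d.+1) \sum_(l < d | (l < i)%N) F i l).
  rewrite /green size_f; apply: eq_bigr => i _.
  by rewrite /frob_trace (big_ord_widen d (F i)) // -ltnS.
exact: pair_big_dep.
Qed.

(* If y is orthogonal to ker f, the polynomial x |-> green f x y of degree    *)
(* less than q^d vanishes on the q^d elements of ker f, hence is zero; its    *)
(* coefficient in degree q^(d-1) is a nonzero multiple of a power of y^(1/q). *)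
Lemma green_nondegr y : adjoint_act emb f y = 0 ->
  (forall x, twisted_act emb f x = 0 -> green emb f x y = 0) -> y = 0.
Proof.
move=> fy gy; have [d0|d_gt0] := posnP d.
  move: fy; rewrite -(qrootK Fq d y) adjoint_actE horner_additive_poly d0.
  by move/eqP; rewrite big_ord1 !expr1 mulf_eq0 (negbTE c_adj0) => /eqP.
have d_lt : (d.-1 < d)%N by rewrite prednK.
have : (rho d * qroot Fq d y) ^+ (q ^ d.-1) = 0.
  apply: (additive_poly_isolated_coef kbar c0 cd
    (P := fun p : 'I_d.+1 * 'I_d => (p.2 < p.1)%N)
    (s := fun p => (rho p.1 * qroot Fq p.1 y) ^+ (q ^ p.2))
    (x := fun p => p.2) (i0 := (ord_max, Ordinal d_lt))) => //= [[i l]|z].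
    move=> /= li ld; congr (_, _); apply: val_inj => //=.
    by apply/eqP; rewrite ld prednK // in li; rewrite eqn_leq li -ltnS ltn_ord.
  rewrite -twisted_actE => /gy {2}<-; rewrite green_pairs.
  by apply: eq_bigr => p _; rewrite -exprMn.
move=> /eqP; rewrite expf_eq0 mulf_eq0 (negbTE (rho_neq0 fd)) /=.
by move=> /andP[_ /eqP y0]; rewrite -(qrootK Fq d y) y0 (frob0 Fq Lbar).
Qed.

Lemma green_nondegl x : twisted_act emb f x = 0 ->
  (forall y, adjoint_act emb f y = 0 -> green emb f x y = 0) -> x = 0.
Proof.
move=> fx gx; have [d0|d_gt0] := posnP d.
  move: fx; rewrite twisted_actE horner_additive_poly d0 big_ord1.
  by move/eqP; rewrite expr1 mulf_eq0 (negbTE c0) => /eqP.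
have : (rho d * x) ^+ (q ^ 0) = 0.
  apply: (additive_poly_isolated_coef kbar c_adj0 c_adjd
    (P := fun p : 'I_d.+1 * 'I_d => (p.2 < p.1)%N)
    (s := fun p => (rho p.1 * x) ^+ (q ^ p.2))
    (x := fun p => (d - p.1 + p.2)%N) (i0 := (ord_max, Ordinal d_gt0))) => //=.
  - move=> [i l] /= li; have le_id := ltnSE (ltn_ord i).
    by rewrite -[X in (_ < X)%N](subnK le_id) ltn_add2l.
  - move=> [i l] /= li /eqP; rewrite subnn addn_eq0 subn_eq0.
    move=> /andP[di /eqP l0]; congr (_, _); apply: val_inj => //=.
    by apply/eqP; rewrite eqn_leq di -ltnS ltn_ord.
  move=> z; rewrite -adjoint_actE => /gx {2}<-; rewrite green_pairs.
  apply: eq_bigr => -[i l] _ /=; rewrite qroot_exp -1?ltnS // expnD exprM.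
  by rewrite -exprMn mulrAC.
by rewrite expr1 => /eqP; rewrite mulf_eq0 (negbTE (rho_neq0 fd)) => /eqP.
Qed.

End TwistedKernels.

(** * Homomorphisms from K/A *)

Section QuotHom.
Variables (R A : comNzRingType) (K : fieldType) (r : {rmorphism R -> A}).
Variables (e : {rmorphism A -> K}) (M : lmodType R).
Local Notation H := (quot_hom r e M).

Lemma quot_hom0 (f : H) : f 0 = 0.
Proof. by rewrite -(rmorph0 e) quot_hom_int. Qed.

Lemma quot_hom_sum (f : H) (I : Type) (s : seq I) (E : I -> K) :
  f (\sum_(i <- s) E i) = \sum_(i <- s) f (E i).
Proof. exact: (big_morph f (quot_homD f) (quot_hom0 f)). Qed.

Lemma quot_hom_divisible (f : H) c : e c != 0 ->
  (forall x, f (e x / e c) = 0) -> exists g : H, f = c *: g.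
Proof.
move=> c0 fc; unshelve eexists; first exists (fun x => f (x / e c)).
- by move=> x y; rewrite mulrDl quot_homD.
- exact: fc.
- by move=> b x; rewrite -mulrA quot_homZ.
by apply: quot_hom_ext => x /=; rewrite mulrAC divff // mul1r.
Qed.

Lemma nbhs_quot_hom_eval (f : H) x : nbhs f [set g : H | g x = f x].
Proof.
have ptws_cont : continuous (@quot_hom_fun _ _ _ r e M :
    H -> {ptws K -> discrete_topology M}) by exact: initial_continuous.
pose eval_x (g : {ptws K -> discrete_topology M}) := g x.
have eval_cont : continuous eval_x.
  exact: (@proj_continuous K (fun=> discrete_topology M) x).
have := ptws_cont f; move/(_ (eval_x @^-1` [set f x])); apply.
exact: eval_cont (discrete_set1 (f x : discrete_topology M)).
Qed.

Lemma cvg_quot_hom (T : topologicalType) (F : T -> H) (t : T) :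
  (forall x, nbhs t [set t' | F t' x = F t x]) -> F t' @[t' --> t] --> F t.
Proof.
move=> F_loc; pose ptws (f : H) : {ptws K -> discrete_topology M} := f.
have F_ptws : ptws (F t') @[t' --> t] --> ptws (F t).
  apply/cvg_sup => x U [_ [[V _ <-] Vf sVU]].
  by apply: filterS (F_loc x) => t' /= Ft'; apply: sVU; rewrite /= /ptws Ft'.
move=> U [_ [[V V_open <-] Vf sVU]].
have nbhs_V : nbhs t [set t' | V (ptws (F t'))].
  exact: F_ptws V (open_nbhs_nbhs (conj V_open Vf)).
have subU : [set t' | V (ptws (F t'))] `<=` [set t' | U (F t')].
  by move=> t'; apply: sVU.
exact: filterS subU nbhs_V.
Qed.

End QuotHom.

(** * Valuations and completions *)

Section Valuation.
Variables (F : fieldType) (v : discrete_valuation F).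
Implicit Types (x y : F) (n m : int).

Lemma val_ge0 n : val_ge v n 0.
Proof. by rewrite /val_ge eqxx. Qed.

Lemma val_geE n x : x != 0 -> val_ge v n x = (n <= v x).
Proof. by rewrite /val_ge => /negbTE ->. Qed.

Lemma dval1 : v 1 = 0.
Proof.
by apply: (addrI (v 1)); rewrite -dvalM ?oner_neq0 // mulr1 addr0.
Qed.

Lemma dvalV x : x != 0 -> v x^-1 = - v x.
Proof.
move=> x0; apply/eqP; rewrite -addr_eq0 -dvalM ?invr_eq0 // mulVf //.
by rewrite dval1.
Qed.

Lemma dvalN1 : v (-1) = 0.
Proof.
have N1_neq0 : (-1 : F) != 0 by rewrite oppr_eq0 oner_neq0.
have := dvalM v N1_neq0 N1_neq0; rewrite mulrNN mulr1 dval1 => /esym/eqP.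
by rewrite -mulr2n mulrn_eq0 => /eqP.
Qed.

Lemma dvalX x (n : nat) : x != 0 -> v (x ^+ n) = v x *+ n.
Proof.
move=> x0; elim: n => [|n IH]; first by rewrite dval1.
by rewrite exprS dvalM ?expf_neq0 // IH mulrS.
Qed.

Lemma val_geD n x y : val_ge v n x -> val_ge v n y -> val_ge v n (x + y).
Proof.
have [->|x0] := eqVneq x 0; first by rewrite add0r.
have [->|y0] := eqVneq y 0; first by rewrite addr0.
have [->|xy0] := eqVneq (x + y) 0; first by rewrite val_ge0.
rewrite !val_geE // => nx ny; apply: le_trans (dvalD v x0 y0 xy0).
by rewrite le_min nx.
Qed.

Lemma val_geM n m x y :
  val_ge v n x -> val_ge v m y -> val_ge v (n + m) (x * y).
Proof.
have [->|x0] := eqVneq x 0; first by rewrite mul0r !val_ge0.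
have [->|y0] := eqVneq y 0; first by rewrite mulr0 !val_ge0.
by rewrite !val_geE ?mulf_neq0 // dvalM //; apply: lerD.
Qed.

Lemma val_geX (n : nat) x : val_ge v 1 x -> val_ge v n%:Z (x ^+ n).
Proof.
move=> x1; elim: n => [|n IH]; last by rewrite exprS -[n.+1]add1n PoszD val_geM.
by rewrite val_geE ?oner_neq0 // dval1.
Qed.

Lemma val_geN n x : val_ge v n x -> val_ge v n (- x).
Proof.
have [->|x0] := eqVneq x 0; first by rewrite oppr0.
rewrite !val_geE ?oppr_eq0 // -mulN1r dvalM ?oppr_eq0 ?oner_neq0 //.
by rewrite dvalN1 add0r.
Qed.

Lemma val_geB n x y : val_ge v n x -> val_ge v n y -> val_ge v n (x - y).
Proof. by move=> hx hy; apply: val_geD => //; apply: val_geN. Qed.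

Lemma val_geW n m x : m <= n -> val_ge v n x -> val_ge v m x.
Proof.
move=> mn; have [->|x0] := eqVneq x 0; first by rewrite !val_ge0.
by rewrite !val_geE //; apply: le_trans.
Qed.

Lemma val_ge_dval x : val_ge v (v x) x.
Proof. by rewrite /val_ge lexx orbT. Qed.

Lemma dval_eqP n x : x != 0 ->
  reflect (v x = n) (val_ge v n x && ~~ val_ge v (n + 1) x).
Proof.
move=> x0; rewrite !val_geE // addrC lez1D -leNgt.
by rewrite andbC -eq_le; apply: eqP.
Qed.

Lemma dval_near n x y : x != 0 -> v x = n -> val_ge v (n + 1) (x - y) ->
  y != 0 /\ v y = n.
Proof.
move=> x0 /(dval_eqP _ x0) /andP[xn xn1] xy.
have yn1 : ~~ val_ge v (n + 1) y.
  by apply: contra xn1 => yn1; rewrite -(subrK y x); apply: val_geD.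
have y0 : y != 0 by apply: contraNneq yn1 => ->; apply: val_ge0.
split=> //; apply/(dval_eqP _ y0); rewrite yn1 andbT -(subKr x y).
by apply: val_geB => //; apply: val_geW xy; rewrite lerDl.
Qed.

End Valuation.

Lemma ideal_power1 (A : comNzRingType) (I : idealr A) (x : A) :
  ideal_power I 1 x <-> x \in I.
Proof.
split=> [[s [sI ->]]|xI].
  by rewrite big_seq; apply: rpred_sum => ab /sI [abI _]; rewrite mulrC idealMr.
exists [:: (x, 1)]; split=> [ab|]; last by rewrite big_seq1 mulr1.
by rewrite inE => /eqP ->.
Qed.

Section Completion.
Variables (A : comNzRingType) (K : fieldType) (i : {rmorphism A -> K}).
Variables (q : prime_idealr A) (Aq : comNzRingType) (Kq : fieldType).
Variables (j : {rmorphism A -> Aq}) (k : {rmorphism K -> Kq}).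
Variables (e : {rmorphism Aq -> Kq}) (v : discrete_valuation Kq).
Hypothesis hq : completion_at i q j k e v.

Lemma completion_integral x : val_ge v 0 x -> exists c, e c = x.
Proof. by move/(completion_int hq). Qed.

Lemma val_ge_integral c : val_ge v 0 (e c).
Proof. by apply/(completion_int hq); exists c. Qed.

Lemma val_ge_power n b : val_ge v n%:Z (e (j b)) <-> ideal_power q n b.
Proof. by rewrite -(completion_comm hq); apply: completion_val hq b n. Qed.

Lemma val_ge_ideal b : val_ge v 1 (e (j b)) <-> b \in q.
Proof. by rewrite -ideal_power1; apply: val_ge_power. Qed.

Lemma completion_inverse c : ~~ val_ge v 1 (e c) -> exists c', c' * c = 1.
Proof.
move=> c1; have c0 : e c != 0 by apply: contraNneq c1 => ->; apply: val_ge0.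
have vc : v (e c) = 0 by apply/(dval_eqP _ _ c0); rewrite val_ge_integral.
have [|c' c'E] := @completion_integral (e c)^-1.
  by rewrite val_geE ?invr_eq0 // dvalV // vc oppr0.
exists c'; apply: (completion_int_inj hq).
by rewrite rmorphM c'E mulVf // rmorph1.
Qed.

Lemma inverse_modulo_prime b : b \notin q -> exists b', 1 - b' * b \in q.
Proof.
move=> bq; have [|c cb] := @completion_inverse (j b).
  by apply/negP => /val_ge_ideal; apply/negP.
have [b' b'c] := completion_int_dense hq c 1; exists b'; apply/val_ge_ideal.
have -> : e (j (1 - b' * b)) = e (c - j b') * e (j b).
  by rewrite -rmorphM mulrBl cb rmorphB rmorphM rmorph1.
by rewrite -[1]addr0; apply: val_geM (val_ge_integral _).
Qed.

Section Characteristic.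
Variables (L : fieldType) (iota : {rmorphism A -> L}).
Hypothesis q_neq_char : ~ (q =i [pred a | iota a == 0]).

Lemma prime_not_in_kernel : exists2 a, a \in q & iota a != 0.
Proof.
apply: contrapT => no_a; have q_ker x : x \in q -> iota x = 0.
  by move=> xq; apply: contrapT => /eqP x0; apply: no_a; exists x.
apply: q_neq_char => b; rewrite inE; apply/idP/idP => [/q_ker ->//|/eqP b0].
apply: contraT => /inverse_modulo_prime [b' /q_ker /eqP].
by rewrite rmorphB rmorphM rmorph1 b0 mulr0 subr0 oner_eq0.
Qed.

(* If a uniformizer b is in the kernel of iota, correct it by the square of   *)
(* an element of q outside this kernel.                                       *)
Lemma uniformizer_exists : exists2 a, iota a != 0 & v (e (j a)) = 1.
Proof.
have [a0 /val_ge_ideal a0q ia0] := prime_not_in_kernel.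
have [x x0 vx] := dval_onto v.
have [|c cE] := @completion_integral x; first by rewrite val_geE ?vx.
have [b bc] := completion_int_dense hq c 2; rewrite rmorphB cE in bc.
have [ib|ib] := eqVneq (iota b) 0; last first.
  by exists b; have [] := dval_near x0 vx bc.
exists (b + a0 ^+ 2).
  by rewrite rmorphD ib add0r rmorphXn expf_neq0.
apply: (dval_near x0 vx _).2.
rewrite !rmorphD opprD addrA; apply: val_geB => //.
by rewrite expr2 !rmorphM; apply: val_geM.
Qed.

End Characteristic.

Variable a : A.
Hypothesis va : v (e (j a)) = 1.
Local Notation w := (e (j a)).

Lemma uniformizer_neq0 : w != 0.
Proof. by apply/eqP => w0; move: va; rewrite w0 dval0. Qed.

Let wX_neq0 n : w ^+ n != 0. Proof. exact/expf_neq0/uniformizer_neq0. Qed.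

Lemma val_ge_uniformizerM n m x :
  val_ge v (n%:Z + m) (w ^+ n * x) = val_ge v m x.
Proof.
have [->|x0] := eqVneq x 0; first by rewrite mulr0 !val_ge0.
rewrite !val_geE ?mulf_neq0 // dvalM // dvalX ?uniformizer_neq0 //.
by rewrite va natz lerD2l.
Qed.

Lemma val_ge_uniformizerX n : val_ge v n%:Z (w ^+ n).
Proof. by apply: val_geX; rewrite -va val_ge_dval. Qed.

Lemma val_ge_div n x : val_ge v n%:Z x -> exists c, x = w ^+ n * e c.
Proof.
move=> xn; have [|c cE] := @completion_integral (x / w ^+ n).
  by rewrite -(val_ge_uniformizerM n) addr0 mulrC divfK.
by exists c; rewrite cE mulrC divfK.
Qed.

Lemma ideal_power_uniformizerM n m b :
  ideal_power q n b -> ideal_power q (m + n) (a ^+ m * b).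
Proof.
move/val_ge_power => bn; apply/val_ge_power.
by rewrite PoszD !rmorphM !rmorphXn val_ge_uniformizerM.
Qed.

Lemma ideal_power_digit n b :
  ideal_power q n b -> exists d, ideal_power q n.+1 (b - a ^+ n * d).
Proof.
move=> /val_ge_power /val_ge_div [c bE].
have [d dc] := completion_int_dense hq c 1; exists d; apply/val_ge_power.
rewrite -addn1 PoszD !rmorphB bE !rmorphM !rmorphXn -mulrBr -rmorphB.
by rewrite val_ge_uniformizerM.
Qed.

Lemma uniformizer_nonunit c : e c != w^-1.
Proof.
apply/eqP => ec; have := val_ge_integral c.
rewrite ec val_geE ?invr_eq0 ?uniformizer_neq0 // dvalV ?uniformizer_neq0 //.
by rewrite va.
Qed.

Lemma uniformizer_div_or_unit c :
  (exists c', c = j a * c') \/ (exists c', c' * c = 1).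
Proof.
have [/(@val_ge_div 1) [c' ec]|c1] := boolP (val_ge v 1 (e c)); last first.
  by right; apply: completion_inverse.
by left; exists c'; apply: (completion_int_inj hq); rewrite ec rmorphM expr1.
Qed.

Lemma completion_series (u : nat -> Aq) : exists c, forall n, exists c',
  c = \sum_(m < n) u m * j a ^+ m + j a ^+ n * c'.
Proof.
pose U n := \sum_(m < n) u m * j a ^+ m.
have U_cauchy (n m : nat) : (n <= m)%N -> val_ge v n (e (U m) - e (U n)).
  move=> /subnK <-; elim: {m}(m - n)%N => [|m IH].
    by rewrite subrr val_ge0.
  rewrite addSn [U _.+1]big_ord_recr /= rmorphD -/(U _) addrAC.
  apply: val_geD => //; rewrite addnC exprD mulrCA -[n%:Z]addr0.
  by rewrite rmorphM rmorphXn val_ge_uniformizerM val_ge_integral.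
have [|l lP] := completion_complete hq (u := fun n => e (U n)).
  move=> n; exists n => m m' nm nm'; rewrite -[_ - _](subrKA (e (U n))).
  by rewrite -[e (U n) - _]opprB; apply: val_geB; apply: U_cauchy.
have lU n : val_ge v n%:Z (l - e (U n)).
  have [m0 m0P] := lP n; have := m0P _ (leq_maxl m0 n).
  have := U_cauchy _ _ (leq_maxr m0 n); set m := maxn _ _ => Umn Uml.
  by have := val_geB Umn Uml; rewrite opprB addrC subrKA.
have [|c cE] := @completion_integral l.
  by have := lU 0%N; rewrite /U big_ord0 rmorph0 subr0.
exists c => n; have [c' c'E] := val_ge_div (lU n); exists c'.
apply: (completion_int_inj hq).
by rewrite rmorphD cE rmorphM rmorphXn -c'E addrC subrK.
Qed.

Definition principal_part n b x := val_ge v 0 (x - e (j b) / w ^+ n).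

Lemma val_ge_pole n x : (val_ge v (- n%:Z) x) = (val_ge v 0 (w ^+ n * x)).
Proof. by rewrite -(val_ge_uniformizerM n) addrN. Qed.

Lemma pole_order x : val_ge v (- `|v x|%:Z) x.
Proof.
by apply: val_geW (val_ge_dval v x); rewrite abszE; apply: lerNnormlW.
Qed.

Lemma common_pole_order x y :
  exists n : nat, val_ge v (- n%:Z) x /\ val_ge v (- n%:Z) y.
Proof.
have pole_le z n : (`|v z| <= n)%N -> val_ge v (- n%:Z) z.
  by move=> zn; apply: val_geW (pole_order z); rewrite lerN2 lez_nat.
by exists (maxn `|v x| `|v y|); rewrite !pole_le ?leq_maxl ?leq_maxr.
Qed.

Lemma pole_orderM c x : val_ge v (- `|v x|%:Z) (e c * x).
Proof.
by rewrite -[- _]add0r; apply: val_geM (val_ge_integral _) (pole_order x).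
Qed.

Lemma principal_part_exists n x :
  val_ge v (- n%:Z) x -> exists b, principal_part n b x.
Proof.
rewrite val_ge_pole => /completion_integral [c cE].
have [b bc] := completion_int_dense hq c n; exists b.
rewrite /principal_part -(val_ge_uniformizerM n) addr0 mulrBr.
by rewrite [_ * (_ / _)]mulrC divfK // -cE -rmorphB.
Qed.

Lemma principal_part_pole n b : principal_part n b (e (j b) / w ^+ n).
Proof. by rewrite /principal_part subrr val_ge0. Qed.

Lemma principal_part_integral n x : val_ge v 0 x -> principal_part n 0 x.
Proof. by rewrite /principal_part !rmorph0 mul0r subr0. Qed.

Lemma principal_partD n b b' x y : principal_part n b x ->
  principal_part n b' y -> principal_part n (b + b') (x + y).
Proof.
by rewrite /principal_part !rmorphD mulrDl opprD addrACA; apply: val_geD.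
Qed.

Lemma principal_partZ n d b x :
  principal_part n b x -> principal_part n (d * b) (e (j d) * x).
Proof.
rewrite /principal_part !rmorphM -mulrA -mulrBr -[X in _ -> val_ge _ X _]addr0.
by apply: val_geM; apply: val_ge_integral.
Qed.

Lemma principal_part_raise m n b x :
  principal_part n b x -> principal_part (m + n) (a ^+ m * b) x.
Proof.
rewrite /principal_part !rmorphM !rmorphXn exprD invfM mulrACA divff //.
by rewrite mul1r.
Qed.

Lemma principal_part_unique n b b' x :
  principal_part n b x -> principal_part n b' x -> ideal_power q n (b - b').
Proof.
move=> bx b'x; apply/val_ge_power; have := val_geB b'x bx.
rewrite opprB addrC subrKA -mulrBl -!rmorphB -(val_ge_uniformizerM n) addr0.
by rewrite mulrC divfK.
Qed.

Section QuotHom.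
Variables (R : comNzRingType) (r : {rmorphism R -> Aq}) (M : lmodType R).
Implicit Type f : quot_hom r e M.

Lemma quot_hom_val_ge0 f x : val_ge v 0 x -> f x = 0.
Proof. by move/completion_integral => [c <-]; rewrite quot_hom_int. Qed.

Lemma quot_hom_principal_part f n b x :
  principal_part n b x -> f x = f (e (j b) / w ^+ n).
Proof.
move=> bx; rewrite -[in LHS](subrK (e (j b) / w ^+ n) x) quot_homD.
by rewrite quot_hom_val_ge0 ?add0r.
Qed.

End QuotHom.

End Completion.

(** * Finiteness of the residue field *)

Section ResidueField.
Variables (F : fieldType) (A : comAlgType F) (K : fieldType).
Variables (i : {rmorphism A -> K}) (q : prime_idealr A).
Variables (Aq : comNzRingType) (Kq : fieldType) (j : {rmorphism A -> Aq}).
Variables (k : {rmorphism K -> Kq}) (e : {rmorphism Aq -> Kq}).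
Variables (v : discrete_valuation Kq) (a : A).
Hypotheses (hq : completion_at i q j k e v) (va : v (e (j a)) = 1).
Hypothesis i_inj : injective i.

Lemma residue_field_span m :
    (forall u : 'I_m -> K, poly_dependent (i \o GRing.in_alg A) (i a) u) ->
  exists n (d : 'I_n -> A), spans_modulo (fun b => b \in q) d.
Proof.
move=> dep; apply: (@spans_modulo_exists _ _ (fun b => b \in q)).
  by move=> c x xq; rewrite -mulr_algl idealMr.
move=> u; have [P P0 relK] := dep (i \o u).
have relA : poly_dependent (GRing.in_alg A) a u.
  exists P => //; apply: i_inj; rewrite rmorph0 -[RHS]relK rmorph_sum.
  by apply: eq_bigr => s _; rewrite rmorphM map_poly_comp horner_map.
have a_reg : GRing.lreg a.
  move=> x y /(congr1 i); rewrite !rmorphM => /mulfI xy; apply/i_inj/xy.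
  apply: contra_eq_neq va => ia0.
  by rewrite -(completion_comm hq) ia0 rmorph0 dval0.
have [c c0 [d dE]] := poly_dependent_modulo a_reg relA; exists c => //.
under eq_bigr do rewrite -mulr_algl.
rewrite dE mulrC idealMr //; apply/(val_ge_ideal hq).
by rewrite -va val_ge_dval.
Qed.

End ResidueField.

(** * Tate modules *)

Definition finite_divisible (A : comNzRingType) (a : A) (M : lmodType A) :=
  (forall n, finite_set [set m : M | a ^+ n *: m = 0]) /\
  (forall m : M, exists m', a *: m' = m).

Section PowerTorsion.
Variables (A : comNzRingType) (I : {pred A}) (M : lmodType A).

Definition power_torsion n (m : M) := forall b, ideal_power I n b -> b *: m = 0.
Local Notation torsion := power_torsion.

Lemma power_torsionB n m m' : torsion n m -> torsion n m' -> torsion n (m - m').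
Proof. by move=> hm hm' b bn; rewrite scalerBr hm // hm' // subr0. Qed.

Lemma power_torsionZ n c m : torsion n m -> torsion n (c *: m).
Proof. by move=> hm b bn; rewrite scalerA mulrC -scalerA hm // scaler0. Qed.

Lemma power_torsion_sum n (J : Type) (s : seq J) (E : J -> M) :
  (forall l, torsion n (E l)) -> torsion n (\sum_(l <- s) E l).
Proof. by move=> hE b bn; rewrite scaler_sumr big1 // => l _; apply: hE. Qed.

Lemma power_torsion_congr n b b' m :
  torsion n m -> ideal_power I n (b - b') -> b *: m = b' *: m.
Proof.
by move=> hm /hm; rewrite scalerBl => /eqP; rewrite subr_eq0 => /eqP.
Qed.

End PowerTorsion.

Section Tate.
Variables (A : comNzRingType) (K : fieldType) (i : {rmorphism A -> K}).
Variables (q : prime_idealr A) (Aq : comNzRingType) (Kq : fieldType).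
Variables (j : {rmorphism A -> Aq}) (k : {rmorphism K -> Kq}).
Variables (e : {rmorphism Aq -> Kq}) (v : discrete_valuation Kq) (a : A).
Hypotheses (hq : completion_at i q j k e v) (va : v (e (j a)) = 1).
Local Notation w := (e (j a)).
Local Notation torsion := (power_torsion q).
Local Notation principal_part := (principal_part j e v a).

Let wX_neq0 n : w ^+ n != 0.
Proof. exact/expf_neq0/(uniformizer_neq0 va). Qed.

Lemma val_ge_uniformizerV n : val_ge v (- n%:Z) (w ^- n).
Proof.
by rewrite (val_ge_pole va) divff // -(rmorph1 e) (val_ge_integral hq).
Qed.

Variable M : lmodType A.
Local Notation T := (quot_hom j e M).
Implicit Types (m : M) (t : T).

Lemma power_torsion_uniformizer n m : torsion n m -> a ^+ n *: m = 0.
Proof.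
apply; apply/(val_ge_power hq); rewrite !rmorphXn.
exact: (val_ge_uniformizerX va).
Qed.

Lemma power_torsion_uniformizerZ n l m :
  torsion (l + n) m -> torsion n (a ^+ l *: m).
Proof.
move=> hm b bn; rewrite scalerA mulrC; apply: hm.
exact: (ideal_power_uniformizerM hq va).
Qed.

Section FiniteDivisible.
Hypothesis M_fin : finite_divisible a M.

(* On M[a^n] every element of q^n acts as one of q^(n+1), so the finite       *)
(* submodule spanned by q^n M[a^n] equals its multiple by q.                  *)
Lemma power_product_annihilator n : exists2 x, x \in q & forall b m,
  ideal_power q n b -> a ^+ n *: m = 0 -> (1 - x) *: (b *: m) = 0.
Proof.
have [s sE] : exists s : seq M, [set m | a ^+ n *: m = 0] = [set` s].
  exact/finite_seqP/(M_fin.1).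
have sP m : a ^+ n *: m = 0 <-> m \in s.
  by have /seteqP[sub_s sup_s] := sE; split=> [/sub_s|/sup_s].
pose in_product y :=
  exists b m, [/\ ideal_power q n b, a ^+ n *: m = 0 & y = b *: m].
pose ys := [seq y <- s | `[< in_product y >]].
have ysP y : y \in ys <-> in_product y.
  rewrite mem_filter; split=> [/andP[/asboolP]//|y_prod].
  apply/andP; split; first exact/asboolP.
  have [b [m [_ hm ->]]] := y_prod.
  by apply/sP; rewrite scalerA mulrC -scalerA hm scaler0.
have [y /ysP [b [m [bn hm ->]]]|x xq xys] := @nakayama _ _ q ys; last first.
  by exists x => // b m bn hm; apply/xys/ysP; exists b, m.
have [d [r [rP rE]]] := ideal_power_digit hq va bn.
exists [seq (z.1, z.2 *: m) | z <- r]; split=> [_ /mapP[z zr ->]|].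
  by have [z1 z2] := rP z zr; split=> //=; apply/ysP; exists z.2, m.
rewrite big_map -[b](subrK (a ^+ n * d)) rE scalerDl [a ^+ n * d]mulrC.
rewrite -[(d * _) *: m]scalerA hm scaler0 addr0 scaler_suml.
by apply: eq_bigr => z _; rewrite scalerA.
Qed.

Lemma power_torsion_projector n : exists2 h, ideal_power q n (1 - h) &
  forall m, a ^+ n *: m = 0 -> torsion n (h *: m).
Proof.
have [x xq x_ann] := power_product_annihilator n.
exists (1 - x ^+ n) => [|m hm b bn].
  rewrite subKr; apply/(val_ge_power hq); rewrite !rmorphXn.
  by apply: val_geX; apply/(val_ge_ideal hq).
rewrite -[in 1 - _](expr1n A n) subrXX; set g := \sum_(_ < _) _.
have -> : b *: (((1 - x) * g) *: m) = g *: ((1 - x) *: (b *: m)).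
  by rewrite !scalerA; congr (_ *: _); ring.
by rewrite x_ann ?scaler0.
Qed.

Lemma power_torsion_lift n m :
  torsion n m -> exists m', torsion n.+1 m' /\ a *: m' = m.
Proof.
move=> hm; have [m' m'E] := M_fin.2 m.
have [h h1 hP] := power_torsion_projector n.+1.
exists (h *: m'); split.
  by apply: hP; rewrite exprSr -scalerA m'E power_torsion_uniformizer.
rewrite scalerA mulrC -scalerA m'E -[RHS]scale1r.
apply: power_torsion_congr hm _; apply/(val_ge_power hq).
rewrite -opprB !rmorphN; apply: val_geN.
by apply: val_geW ((val_ge_power hq _ _).2 h1); rewrite lez_nat.
Qed.

End FiniteDivisible.

Lemma tate_torsion t n x : val_ge v (- n%:Z) x -> torsion n (t x).
Proof.
move=> xn b /(val_ge_power hq) bn; rewrite -quot_homZ (quot_hom_val_ge0 hq) //.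
by rewrite -(addrN n%:Z) val_geM.
Qed.

Lemma tate_principal_part t n b x :
  principal_part n b x -> t x = b *: t (w ^- n).
Proof.
by move/(quot_hom_principal_part hq) => ->; rewrite quot_homZ.
Qed.

Lemma tate_ext t t' : (forall n, t (w ^- n) = t' (w ^- n)) -> t = t'.
Proof.
move=> tt'; apply: quot_hom_ext => x.
have [b bx] := principal_part_exists hq va (pole_order v x).
by rewrite !(tate_principal_part _ bx) tt'.
Qed.

Lemma tate_divisible t n : t (w ^- n) = 0 -> exists t' : T, t = j a ^+ n *: t'.
Proof.
move=> t0; apply: quot_hom_divisible => [|c]; rewrite rmorphXn //.
have [|b bx] := principal_part_exists hq va (n := n) (x := e c / w ^+ n).
  by rewrite (val_ge_pole va) mulrC divfK // (val_ge_integral hq).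
by rewrite (tate_principal_part _ bx) t0 scaler0.
Qed.

Section Sequence.
Variable u : nat -> M.
Hypothesis u_tors : forall n, torsion n (u n).
Hypothesis u_succ : forall n, a *: u n.+1 = u n.

Let u_add l n : a ^+ l *: u (l + n)%N = u n.
Proof.
elim: l => [|l IH]; first by rewrite scale1r.
by rewrite addSn exprSr -scalerA u_succ.
Qed.

Let value_unique n b n' b' x :
  principal_part n b x -> principal_part n' b' x -> b *: u n = b' *: u n'.
Proof.
move=> bx b'x; rewrite -(u_add n' n) -(u_add n n') !scalerA [(n + n')%N]addnC.
rewrite mulrC [b' * _]mulrC; apply: power_torsion_congr (@u_tors _) _.
apply: (principal_part_unique hq va (principal_part_raise va n' bx)).
by rewrite addnC; apply: principal_part_raise.
Qed.

Lemma tate_of_sequence : exists t : T, forall n, t (w ^- n) = u n.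
Proof.
have /choice [b bP] x := principal_part_exists hq va (pole_order v x).
pose f x := b x *: u `|v x|%N.
have fE n c x : principal_part n c x -> f x = c *: u n by apply: value_unique.
unshelve eexists; first exists f.
- move=> x y; have [n [xn yn]] := common_pole_order v x y.
  have [c cx] := principal_part_exists hq va xn.
  have [d dy] := principal_part_exists hq va yn.
  rewrite (fE _ _ _ cx) (fE _ _ _ dy) -scalerDl; apply: fE.
  exact: principal_partD.
- move=> c; have := principal_part_integral j e a 0 (val_ge_integral hq c).
  by move=> /fE ->; apply: scale0r.
- move=> c x; rewrite (fE _ _ _ (bP x)) scalerA; apply: fE.
  exact: (principal_partZ hq).
move=> n /=; rewrite (fE n 1) ?scale1r //.
by have := principal_part_pole j e v a n 1; rewrite !rmorph1 div1r.
Qed.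

End Sequence.

Lemma tate_lift n m : finite_divisible a M -> torsion n m ->
  exists t : T, t (w ^- n) = m.
Proof.
move=> M_fin hm; have /choice [f fP] (x : nat * M) :
    exists m', torsion x.1 x.2 -> torsion x.1.+1 m' /\ a *: m' = x.2.
  have [/(power_torsion_lift M_fin) [m' m'P]|nx] := pselect (torsion x.1 x.2).
    by exists m'.
  by exists 0.
pose u l := iteri l (fun r x => f (n + r, x)%N) m.
have u_tors l : torsion (n + l) (u l).
  by elim: l => [|l IH]; rewrite ?addn0 // addnS; case: (fP (n + l, u l)%N IH).
have u_succ l : a *: u l.+1 = u l by case: (fP (n + l, u l)%N (u_tors l)).
have [|l|t tE] := @tate_of_sequence (fun l => a ^+ n *: u l).
- by move=> l; apply: power_torsion_uniformizerZ.
- by rewrite scalerA mulrC -scalerA u_succ.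
suff u_mul l : a ^+ l *: u l = m by exists t; rewrite tE.
by elim: l => [|l IH]; rewrite ?scale1r // exprSr -scalerA u_succ.
Qed.

End Tate.

(** * Pairings of Tate modules *)

(* The cocycle identity is that of Green's boundary term for a product of     *)
(* operators; it makes the pairings of M[a^n] with N[a^n] balanced over A and *)
(* compatible as n varies.                                                    *)
Record adjoint_pairing (F : fieldType) (A : comAlgType F) (a : A)
    (M N : lmodType A) (p : A -> M -> N -> F) : Prop := AdjointPairing {
  pairing_linl : forall c y, linear_form (GRing.in_alg A) (p c ^~ y);
  pairing_linr : forall c x, linear_form (GRing.in_alg A) (p c x);
  pairing_cocycle : forall b c x y,
    p (b * c) x y = p b (c *: x) y + p c x (b *: y);
  pairing_nondegl : forall n x, a ^+ n *: x = 0 ->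
    (forall y, a ^+ n *: y = 0 -> p (a ^+ n) x y = 0) -> x = 0;
  pairing_nondegr : forall n y, a ^+ n *: y = 0 ->
    (forall x, a ^+ n *: x = 0 -> p (a ^+ n) x y = 0) -> y = 0
}.

Section AdjointPairing.
Variables (F : fieldType) (A : comAlgType F) (a : A) (M N : lmodType A).
Variable p : A -> M -> N -> F.
Hypothesis pP : adjoint_pairing a p.

Let pairing0l c y : p c 0 y = 0.
Proof. exact: linear_form0 (pairing_linl pP c y). Qed.

Let pairing0r c x : p c x 0 = 0.
Proof. exact: linear_form0 (pairing_linr pP c x). Qed.

Lemma pairing_balanced n c x y : a ^+ n *: x = 0 -> a ^+ n *: y = 0 ->
  p (a ^+ n) (c *: x) y = p (a ^+ n) x (c *: y).
Proof.
move=> hx hy; have := pairing_cocycle pP (a ^+ n) c x y.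
by rewrite mulrC (pairing_cocycle pP) hx hy pairing0l pairing0r add0r addr0.
Qed.

Lemma pairing_levell m n x y : a ^+ n *: y = 0 ->
  p (a ^+ (m + n)) x y = p (a ^+ n) (a ^+ m *: x) y.
Proof.
by move=> hy; rewrite exprD mulrC (pairing_cocycle pP) hy pairing0r addr0.
Qed.

Lemma pairing_levelr m n x y : a ^+ n *: x = 0 ->
  p (a ^+ (m + n)) x y = p (a ^+ n) x (a ^+ m *: y).
Proof.
by move=> hx; rewrite exprD (pairing_cocycle pP) hx pairing0l add0r.
Qed.

Lemma adjoint_pairing_sym : adjoint_pairing a (fun c y x => p c x y).
Proof.
split=> [c x|c y|b c y x|n y|n x].
- exact: pairing_linr pP c x.
- exact: pairing_linl pP c y.
- by rewrite mulrC (pairing_cocycle pP) addrC.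
- exact: pairing_nondegr pP n y.
- exact: pairing_nondegl pP n x.
Qed.

End AdjointPairing.

Section TatePairing.
Variables (F : fieldType) (A : comAlgType F) (K : fieldType).
Variables (i : {rmorphism A -> K}) (q : prime_idealr A).
Variables (Aq : comNzRingType) (Kq : fieldType) (j : {rmorphism A -> Aq}).
Variables (k : {rmorphism K -> Kq}) (e : {rmorphism Aq -> Kq}).
Variables (v : discrete_valuation Kq) (a : A).
Hypotheses (hq : completion_at i q j k e v) (va : v (e (j a)) = 1).
Local Notation w := (e (j a)).
Local Notation W := (residue_dual F A j e).
Local Notation torsion := (power_torsion q).

Let wV_pole n : val_ge v (- n%:Z) (w ^- n).
Proof. exact: (val_ge_uniformizerV hq va). Qed.

Let wX_neq0 n : w ^+ n != 0.
Proof. exact/expf_neq0/(uniformizer_neq0 va). Qed.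

Let tate_uniformizer_eq0 (P : lmodType A) (t : quot_hom j e P) n x :
  val_ge v (- n%:Z) x -> a ^+ n *: t x = 0.
Proof.
by move=> xn; apply/(power_torsion_uniformizer hq va)/(tate_torsion hq).
Qed.

Let tate_shift (P : lmodType A) (t : quot_hom j e P) m n :
  a ^+ m *: t (w ^- (m + n)) = t (w ^- n).
Proof.
by rewrite -quot_homZ !rmorphXn exprD invfM mulrA divff ?mul1r.
Qed.

Section BilinearPairing.
Variables (M N : lmodType A) (p : A -> M -> N -> F).
Hypothesis pP : adjoint_pairing a p.
Local Notation TM := (quot_hom j e M).
Local Notation TN := (quot_hom j e N).
Implicit Types (t : TM) (s : TN).

Definition tate_pairing_fun t s x : F^o :=
  p (a ^+ `|v x|) (t x) (s (w ^- `|v x|)).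

Lemma tate_pairing_funE t s n x :
  val_ge v (- n%:Z) x -> tate_pairing_fun t s x = p (a ^+ n) (t x) (s (w ^- n)).
Proof.
have level m l : val_ge v (- l%:Z) x ->
    p (a ^+ (m + l)) (t x) (s (w ^- (m + l))) = p (a ^+ l) (t x) (s (w ^- l)).
  by move=> xl; rewrite (pairing_levelr pP) ?tate_shift ?tate_uniformizer_eq0.
move=> xn; rewrite /tate_pairing_fun -(level n _ (pole_order v x)) addnC.
exact: level.
Qed.

Fact tate_pairing_funD t s x y : tate_pairing_fun t s (x + y) =
  tate_pairing_fun t s x + tate_pairing_fun t s y.
Proof.
have [n [xn yn]] := common_pole_order v x y.
rewrite (tate_pairing_funE _ _ xn) (tate_pairing_funE _ _ yn).
rewrite (tate_pairing_funE _ _ (val_geD xn yn)) quot_homD.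
exact: linear_formD (pairing_linl pP _ _) _ _.
Qed.

Fact tate_pairing_fun_int t s c : tate_pairing_fun t s (e c) = 0.
Proof.
rewrite /tate_pairing_fun quot_hom_int.
exact: linear_form0 (pairing_linl pP _ _).
Qed.

Fact tate_pairing_funZ t s l x :
  tate_pairing_fun t s (e (j l%:A) * x) = l *: tate_pairing_fun t s x.
Proof.
rewrite (tate_pairing_funE _ _ (pole_orderM hq (j l%:A) x)) quot_homZ.
exact: linear_formZ (pairing_linl pP _ _) _ _.
Qed.

Definition tate_pairing t s : W :=
  @QuotHom _ _ _ (j \o GRing.in_alg A) _ _ _
    (tate_pairing_funD t s) (tate_pairing_fun_int t s) (tate_pairing_funZ t s).

Lemma tate_pairingE t s n x : val_ge v (- n%:Z) x ->
  tate_pairing t s x = p (a ^+ n) (t x) (s (w ^- n)).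
Proof. exact: tate_pairing_funE. Qed.

Lemma tate_pairingEr t s n x : val_ge v (- n%:Z) x ->
  tate_pairing t s x = p (a ^+ n) (t (w ^- n)) (s x).
Proof.
move=> xn; have [b bx] := principal_part_exists hq va xn.
rewrite (tate_pairingE _ _ xn) !(tate_principal_part hq _ bx).
by rewrite (pairing_balanced pP) // tate_uniformizer_eq0.
Qed.

Fact tate_pairing_bilinear : bilinear_for *:%R *:%R tate_pairing.
Proof.
split=> [s c t t'|t c s s']; apply: quot_hom_ext => x;
    have xn := pole_order v x; have cxn := pole_orderM hq c x.
  rewrite -[RHS]/(tate_pairing t s (e c * x) + tate_pairing t' s x).
  rewrite !(tate_pairingE _ _ xn) (tate_pairingE _ _ cxn).
  exact: linear_formD (pairing_linl pP _ _) _ _.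
rewrite -[RHS]/(tate_pairing t s (e c * x) + tate_pairing t s' x).
rewrite !(tate_pairingEr _ _ xn) (tate_pairingEr _ _ cxn).
exact: linear_formD (pairing_linr pP _ _) _ _.
Qed.

HB.instance Definition _ := @bilinear_isBilinear.Build Aq TM TN W
  *:%R *:%R tate_pairing tate_pairing_bilinear.

Lemma tate_pairing_continuous :
  continuous (fun ts : TM * TN => tate_pairing ts.1 ts.2 : W).
Proof.
case=> t s; apply: cvg_quot_hom => x; pose n := `|v x|%N.
exists ([set t' : TM | t' x = t x], [set s' : TN | s' (w ^- n) = s (w ^- n)]).
  by split; apply: nbhs_quot_hom_eval.
by case=> t' s' /= [tx sw]; rewrite /tate_pairing_fun tx sw.
Qed.

Lemma tate_pairing_invariant (u : {linear M -> M}) (u' : {linear N -> N}) :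
    (forall n x y, a ^+ n *: x = 0 -> a ^+ n *: y = 0 ->
       p (a ^+ n) (u x) (u' y) = p (a ^+ n) x y) ->
  forall t s,
    tate_pairing (quot_hom_comp u t) (quot_hom_comp u' s) = tate_pairing t s.
Proof.
move=> u_inv t s; apply: quot_hom_ext => x; apply: u_inv.
  exact: tate_uniformizer_eq0 (pole_order v x).
exact: tate_uniformizer_eq0.
Qed.

Lemma pairing_torsion_nondegr n y : finite_divisible a M -> torsion n y ->
  (forall x, torsion n x -> p (a ^+ n) x y = 0) -> y = 0.
Proof.
move=> M_fin hy y_orth; have ya := power_torsion_uniformizer hq va hy.
apply: (pairing_nondegr pP ya) => x hx.
have [h h1 hP] := power_torsion_projector hq va M_fin n.
rewrite -[y]scale1r (power_torsion_congr hy h1) -(pairing_balanced pP) //.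
exact/y_orth/hP.
Qed.

End BilinearPairing.

Lemma tate_pairing_sym (M N : lmodType A) (p : A -> M -> N -> F)
    (pP : adjoint_pairing a p) t s :
  tate_pairing (adjoint_pairing_sym pP) s t = tate_pairing pP t s.
Proof.
apply: quot_hom_ext => x; have xn := pole_order v x.
by rewrite (tate_pairingEr _ _ _ xn) (tate_pairingE _ _ _ xn).
Qed.

Section Perfect.
Variables (M N : lmodType A) (p : A -> M -> N -> F).
Hypothesis pP : adjoint_pairing a p.
Hypotheses (M_fin : finite_divisible a M) (N_fin : finite_divisible a N).
Local Notation TM := (quot_hom j e M).
Local Notation TN := (quot_hom j e N).

Let pairing_torsion_nondegl n x : torsion n x ->
  (forall y, torsion n y -> p (a ^+ n) x y = 0) -> x = 0.
Proof. exact: (pairing_torsion_nondegr (adjoint_pairing_sym pP) N_fin). Qed.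

Lemma tate_pairing_inj (t t' : TM) :
  (forall s : TN, tate_pairing pP t s = tate_pairing pP t' s) -> t = t'.
Proof.
move=> tt'; apply: (tate_ext hq va) => n.
apply/eqP; rewrite -subr_eq0; apply/eqP.
apply: (@pairing_torsion_nondegl n) => [|y /(tate_lift hq va N_fin) [s <-]].
  by apply: power_torsionB; apply: (tate_torsion hq).
rewrite (linear_formB (pairing_linl pP _ _)).
by rewrite -!(tate_pairingE pP _ _ (wV_pole n)) tt' subrr.
Qed.

Section Representation.
Variable g : {linear TN -> W}.

Let g_scale c s x : g (c *: s) x = g s (e c * x).
Proof. by rewrite linearZ. Qed.

(* The form s |-> g s (a^-n) vanishes when s (a^-n) does, as s is then a      *)
(* multiple of a^n; hence it is a combination of the forms                    *)
(* s |-> p (a^n) x (s (a^-n)), for x in the finite module M[q^n].             *)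
Lemma tate_form_repr n : exists x, torsion n x /\
  forall s, g s (w ^- n) = p (a ^+ n) x (s (w ^- n)).
Proof.
have [X XP] : exists X : seq M, [set x | torsion n x] = [set` X].
  apply/finite_seqP; apply: sub_finite_set (M_fin.1 n) => x.
  exact: (power_torsion_uniformizer hq va).
have sub_tors x : x \in X -> torsion n x by have /seteqP[_ +] := XP; apply.
have tors_sub x : torsion n x -> x \in X by have /seteqP[+ _] := XP; apply.
have [l c s s'||s s_orth|c cP] := linear_form_span
    (k := j \o GRing.in_alg A) (V := TN)
    (h := fun l : 'I_(size X) => fun s : TN => p (a ^+ n) X`_l (s (w ^- n)))
    (g := fun s => g s (w ^- n)).
- by rewrite /= quot_homZ (pairing_linr pP).
- by move=> c s s'; rewrite linearD /= g_scale (quot_homZ (g s)).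
- have /(tate_divisible hq va) [s' ->] : s (w ^- n) = 0.
    apply: (pairing_torsion_nondegr pP M_fin (n := n)).
      exact: (tate_torsion hq).
    move=> x /tors_sub /(nthP 0) [l l_lt <-].
    exact: s_orth (Ordinal l_lt).
  by rewrite g_scale rmorphXn divff // -(rmorph1 e) quot_hom_int.
exists (\sum_l (c l)%:A *: X`_l); split=> [|s].
  apply: power_torsion_sum => l; apply/power_torsionZ/sub_tors.
  exact: mem_nth.
rewrite cP (linear_form_sum (pairing_linl pP _ _)); apply: eq_bigr => l _.
by rewrite (linear_formZ (pairing_linl pP _ _)).
Qed.

Lemma tate_pairing_repr : exists t, forall s, tate_pairing pP t s = g s.
Proof.
have /choice [u uP] := tate_form_repr.
have [n|n|t tE] := @tate_of_sequence _ _ _ _ _ _ _ _ _ _ _ hq va M u.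
- by case: (uP n).
- apply/eqP; rewrite -subr_eq0; apply/eqP; apply: (@pairing_torsion_nondegl n).
    apply: power_torsionB; last by case: (uP n).
    rewrite -[a]expr1; apply: (power_torsion_uniformizerZ hq va).
    by case: (uP n.+1).
  move=> y hy; have [s sy] := tate_lift hq va N_fin hy.
  rewrite (linear_formB (pairing_linl pP _ _)) -{1 2}[a]expr1.
  have ya := power_torsion_uniformizer hq va hy.
  rewrite -(pairing_levell pP) // -sy -(uP n).2.
  have wVS : w * w ^- (1 + n) = w ^- n.
    by rewrite exprD invfM mulrA divff ?mul1r ?(uniformizer_neq0 va).
  by rewrite -[in s _]wVS -[s _]/((j a *: s) _) -(uP n.+1).2 g_scale wVS subrr.
exists t => s; apply: quot_hom_ext => x; have xn := pole_order v x.
have [b bx] := principal_part_exists hq va xn.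
rewrite (tate_pairingEr _ _ _ xn) tE (tate_principal_part hq s bx).
rewrite -quot_homZ -[s _]/((j b *: s) _) -(uP _).2 g_scale.
by rewrite -(quot_hom_principal_part hq (g s) bx).
Qed.

End Representation.

Lemma tate_pairing_left_perfect (g : {linear TN -> W}) :
  exists! t, forall s, tate_pairing pP t s = g s.
Proof.
have [t tP] := tate_pairing_repr g; exists t; split=> // t' t'P.
by apply: tate_pairing_inj => s; rewrite tP t'P.
Qed.

End Perfect.

Lemma tate_pairing_perfect (M N : lmodType A) (p : A -> M -> N -> F)
    (pP : adjoint_pairing a p) :
  finite_divisible a M -> finite_divisible a N ->
  perfect_pairing (tate_pairing pP).
Proof.
move=> M_fin N_fin; split=> g; first exact: tate_pairing_left_perfect.
have [s [sP s_uniq]] :=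
  tate_pairing_left_perfect (adjoint_pairing_sym pP) N_fin M_fin g.
exists s; split=> [t|s' s'P]; first by rewrite -tate_pairing_sym.
by apply: s_uniq => t; rewrite tate_pairing_sym.
Qed.

End TatePairing.

(** * The dual of Kq/Aq *)

Section ResidueDual.
Variables (F : fieldType) (A : comAlgType F) (K : fieldType).
Variables (i : {rmorphism A -> K}) (q : prime_idealr A).
Variables (Aq : comNzRingType) (Kq : fieldType) (j : {rmorphism A -> Aq}).
Variables (k : {rmorphism K -> Kq}) (e : {rmorphism Aq -> Kq}).
Variables (v : discrete_valuation Kq) (a : A).
Hypotheses (hq : completion_at i q j k e v) (va : v (e (j a)) = 1).
Local Notation w := (e (j a)).
Local Notation W := (residue_dual F A j e).
Implicit Types (f chi : W).

Let w_neq0 : w != 0. Proof. exact: uniformizer_neq0 va. Qed.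

Lemma residue_dual_generator : exists chi, chi w^-1 = 1.
Proof.
have [||f [f_lin f_int f1]] := @separating_linear_form _ _
    (e \o (j \o GRing.in_alg A)) Kq^o (range e) w^-1.
- split=> [|c _ _ [x _ <-] [y _ <-]]; first by exists 0; rewrite ?rmorph0.
  by exists (j c%:A * x + y) => //; rewrite rmorphD rmorphM.
- by case=> c _ ec; have := uniformizer_nonunit hq va c; rewrite ec eqxx.
unshelve eexists; first exists (f : Kq -> F^o).
- exact: linear_formD f_lin.
- by move=> c; apply: f_int; exists c.
- exact: linear_formZ f_lin.
exact: f1.
Qed.

Let dual_form f (c : Aq) :
  @linear_form _ _ (j \o GRing.in_alg A) Aq^o (fun x => f (e (c * x) / w)).
Proof.
move=> l x y; rewrite -[_ *: x]/(j l%:A * x).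
have -> : e (c * (j l%:A * x + y)) / w =
    e (j l%:A) * (e (c * x) / w) + e (c * y) / w.
  by rewrite !(mulrDr, rmorphD, rmorphM); ring.
by rewrite quot_homD; congr (_ + _); apply: (quot_homZ f).
Qed.

Let dual_div f c : f (e (j a * c) / w) = 0.
Proof. by rewrite rmorphM mulrAC divff // mul1r quot_hom_int. Qed.

Section Digits.
Variables (n : nat) (d : 'I_n -> A).
Hypothesis d_span : spans_modulo (fun b => b \in q) d.

Let dual_combination f (l : 'I_n -> F) x :
  f (e (j (\sum_s l s *: d s) * x) / w) = \sum_s l s * f (e (j (d s) * x) / w).
Proof.
rewrite rmorph_sum mulr_suml rmorph_sum mulr_suml quot_hom_sum.
apply: eq_bigr => s _.
have -> : e (j (l s *: d s) * x) / w = e (j (l s)%:A) * (e (j (d s) * x) / w).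
  by rewrite -(mulr_algl (l s) (d s)) !rmorphM !mulrA.
exact: (quot_homZ f).
Qed.

Lemma residue_digit c : exists l c', c = j (\sum_s l s *: d s) + j a * c'.
Proof.
have [b cb] := completion_int_dense hq c 1.
have [l /(val_ge_ideal hq) bl] := d_span b; exists l.
have [c' c'E] := val_ge_div hq va (n := 1) (val_geD cb bl); exists c'.
apply: (completion_int_inj hq); rewrite rmorphD rmorphM -[w]expr1 -c'E.
by rewrite !rmorphB; ring.
Qed.

Lemma residue_dual_step chi f :
  chi w^-1 = 1 -> exists c f', f = c *: chi + j a *: f'.
Proof.
move=> chi1; have [s||x x_ker|l lP] := linear_form_span
    (k := j \o GRing.in_alg A) (V := Aq^o)
    (h := fun s x => chi (e (j (d s) * x) / w))
    (g := fun x => f (e (1 * x) / w)).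
- exact: dual_form.
- exact: dual_form.
- have [[y ->]|[y yx]] := uniformizer_div_or_unit hq va x.
    by rewrite mul1r dual_div.
  have [l [y' yE]] := residue_digit y; have /eqP := chi1; rewrite -[w^-1]mul1r.
  rewrite -(rmorph1 e) -yx yE mulrDl -mulrA rmorphD mulrDl quot_homD dual_div.
  rewrite dual_combination big1 ?addr0 1?eq_sym ?oner_eq0 // => s _.
  by rewrite x_ker mulr0.
pose c := j (\sum_s l s *: d s); exists c.
have [//|x|f' f'E] := @quot_hom_divisible _ _ _ _ _ _ (f - c *: chi) (j a).
  have := lP x; rewrite mul1r -dual_combination -/c => /= ->.
  by rewrite rmorphM mulrA subrr.
by exists f'; rewrite -f'E addrC subrK.
Qed.

Lemma residue_dual_span chi f : chi w^-1 = 1 -> exists c, f = c *: chi.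
Proof.
move=> chi1; have /choice [step stepP] (g : W) : exists cg : Aq * W,
    g = cg.1 *: chi + j a *: cg.2.
  by have [c [g' gE]] := residue_dual_step g chi1; exists (c, g').
pose rem m := iter m (fun g => (step g).2) f; pose u m := (step (rem m)).1.
have fE m : f = (\sum_(l < m) u l * j a ^+ l) *: chi + j a ^+ m *: rem m.
  elim: m => [|m IH]; first by rewrite big_ord0 scale0r add0r scale1r.
  rewrite {1}IH {1}(stepP (rem m)) big_ord_recr scalerDl -addrA scalerDr.
  by rewrite !scalerA -exprSr [j a ^+ m * _]mulrC.
have [c cP] := completion_series hq va u; exists c; apply: quot_hom_ext => x.
have [c' cE] := cP `|v x|%N.
rewrite (fE `|v x|%N) cE scalerDl /=; congr (_ + _).
have : val_ge v 0 (w ^+ `|v x| * x) by rewrite -(val_ge_pole va) pole_order.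
move=> /(completion_integral hq) [y yE].
by rewrite rmorphM !rmorphXn mulrAC -yE -rmorphM !quot_hom_int.
Qed.

End Digits.

Lemma residue_dual_scale_inj chi c d :
  chi w^-1 = 1 -> c *: chi = d *: chi -> c = d.
Proof.
move=> chi1 cd; apply/eqP; rewrite -subr_eq0; apply/negPn/negP => cd0.
have ecd : e (c - d) != 0.
  apply: contra_neq cd0 => ecd; apply: (completion_int_inj hq).
  by rewrite ecd rmorph0.
have : ((c - d) *: chi) ((e (c - d))^-1 / w) = 0 by rewrite scalerBl cd subrr.
by rewrite /= mulrA divff // mul1r chi1 => /eqP; rewrite oner_eq0.
Qed.

Lemma residue_dual_free :
    (exists n (d : 'I_n -> A), spans_modulo (fun b => b \in q) d) ->
  exists f : {linear Aq^o -> W}, bijective f.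
Proof.
move=> [n [d d_span]]; have [chi chi1] := residue_dual_generator.
pose g (c : Aq^o) : W := (c : Aq) *: chi.
have g_lin : linear g by move=> c x y; rewrite /g scalerDl scalerA.
have /choice [g_inv g_invK] (f : W) := residue_dual_span d_span f chi1.
pose gL : {linear Aq^o -> W} :=
  HB.pack g (GRing.isLinear.Build Aq Aq^o W _ g g_lin).
exists gL.
exists g_inv => [c|f]; last by rewrite [RHS]g_invK.
exact: residue_dual_scale_inj chi1 (esym (g_invK (g c))).
Qed.

End ResidueDual.

(** * The pairing of a Drinfeld module with its adjoint *)

Lemma coef_twisted_mul_lead (Fq : finFieldType) (L : fieldType)
    (f g : {poly L}) :
  f != 0 -> g != 0 ->
  (twisted_mul Fq f g)`_((size f).-1 + (size g).-1) =
    lead_coef f * lead_coef g ^+ (#|Fq| ^ (size f).-1).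
Proof.
rewrite -!size_poly_gt0 /twisted_mul /lead_coef.
case sf: (size f) => [//|m] _; case sg: (size g) => [//|n] _ /=.
rewrite (pair_bigA _ (fun (i : 'I_m.+1) (j : 'I_n.+1) =>
  (f`_i * g`_j ^+ (#|Fq| ^ i)) *: 'X^(i + j))) /=.
apply: (@coef_sum_monomials _ ('I_m.+1 * 'I_n.+1)%type xpredT
  (fun p => f`_p.1 * g`_p.2 ^+ (#|Fq| ^ p.1)) (fun p => p.1 + p.2)%N
  (ord_max, ord_max)) => //= -[i j] _ /= ij.
have := ltn_ord i; have := ltn_ord j; rewrite !ltnS => jn im.
have im_eq : i = m :> nat.
  by apply/eqP; rewrite eqn_leq im -(leq_add2r n) -ij leq_add2l.
congr (_, _); apply: val_inj => //=.
by apply: (@addnI m); rewrite -{1}im_eq.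
Qed.

Lemma twisted_unit_const (Fq : finFieldType) (L : fieldType)
    (k : {rmorphism Fq -> L}) (f g : twisted k) :
  f * g = 1 -> (f : {poly L}) = ((f : {poly L})`_0)%:P.
Proof.
move=> fg; have f0 : (f : {poly L}) != 0.
  by apply/eqP => f0; move/eqP: fg; rewrite [f]f0 [_ * _]mul0r eq_sym oner_eq0.
have g0 : (g : {poly L}) != 0.
  by apply/eqP => g0; move/eqP: fg; rewrite [g]g0 [_ * _]mulr0 eq_sym oner_eq0.
apply: size1_polyC; rewrite -[1%N]add1n -leq_subLR subn1 leqn0.
have := coef_twisted_mul_lead Fq f0 g0; rewrite -[twisted_mul _ _ _]/(f * g) fg.
rewrite coef1 addn_eq0; case: eqP => // _ /esym/eqP.
by rewrite mulf_eq0 expf_eq0 !lead_coef_eq0 (negbTE f0) (negbTE g0) andbF.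
Qed.

Section DrinfeldPairing.
Variables (Fq : finFieldType) (A : comAlgType Fq) (L : fieldType).
Variables (Lbar : closedFieldType) (iota : {rmorphism A -> L}).
Variables (phi : drinfeld_module iota) (emb : {rmorphism L -> Lbar}).
Local Notation M := (drinfeld_points phi emb).
Local Notation N := (adjoint_points phi emb).
Local Notation k := (iota \o GRing.in_alg A).
Local Notation kbar := (emb \o k).

Lemma drinfeld_scalar (l : Fq) : (phi l%:A : {poly L}) = k l *: 'X^0.
Proof.
rewrite expr0 alg_polyC -[k l]/(iota l%:A) -(drinfeld_const phi).
have [->|l0] := eqVneq l 0.
  by rewrite scale0r rmorph0 -[RHS]/(((0 : {poly L})`_0)%:P) coef0.
apply: (@twisted_unit_const _ _ _ _ (phi (l^-1)%:A)).
by rewrite -rmorphM -scalerAl mul1r scalerA divff // scale1r rmorph1.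
Qed.

Lemma drinfeld_points_scalar (l : Fq) (x : M) : l%:A *: x = kbar l * x :> Lbar.
Proof.
rewrite -[LHS]/(twisted_act emb (phi l%:A) x) drinfeld_scalar.
by rewrite twisted_actZX expr1.
Qed.

Lemma adjoint_points_scalar (l : Fq) (y : N) : l%:A *: y = kbar l * y :> Lbar.
Proof.
rewrite -[LHS]/(adjoint_act emb (phi l%:A) y) drinfeld_scalar adjoint_actZX.
rewrite -[emb (k l)]/(kbar l) (qroot_scalar k emb).
by congr (_ * _); apply: (qroot_eq k emb); rewrite expr1.
Qed.

Variable r : Lbar -> Fq.
Hypotheses (r_lin : linear_form (V := Lbar^o) kbar r) (r1 : r 1 = 1).

(* On the torsion the boundary term of Green's identity is Fq-valued, and r   *)
(* is a retraction of Lbar onto Fq that makes the pairing total.              *)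
Definition drinfeld_pairing (c : A) (x : M) (y : N) : Fq :=
  r (green emb (phi c) x y).

Let rK l : r (kbar l) = l.
Proof. by have := linear_formZ r_lin l 1; rewrite [_ *: _]mulr1 r1 mulr1. Qed.

Variable a : A.
Hypothesis iota_a : iota a != 0.

Let phi_a n : (phi (a ^+ n) : {poly L})`_0 != 0.
Proof. by rewrite drinfeld_const rmorphXn expf_neq0. Qed.

Lemma drinfeld_pairingE n (x : M) (y : N) :
  a ^+ n *: x = 0 -> a ^+ n *: y = 0 ->
  kbar (drinfeld_pairing (a ^+ n) x y) = green emb (phi (a ^+ n)) x y.
Proof.
move=> hx hy; have [l lE] := green_ker_in_Fq hx hy.
by rewrite /drinfeld_pairing -lE rK.
Qed.

Lemma drinfeld_adjoint_pairing : adjoint_pairing a drinfeld_pairing.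
Proof.
split=> [c y l x x'|c x l y y'|b c x y|n x hx x_orth|n y hy y_orth].
- rewrite /drinfeld_pairing greenDl drinfeld_points_scalar greenZl.
  exact: r_lin.
- rewrite /drinfeld_pairing greenDr adjoint_points_scalar greenZr.
  exact: r_lin.
- by rewrite /drinfeld_pairing rmorphM greenM (linear_formD r_lin).
- apply: (green_nondegl (phi_a n) hx) => y hy.
  by rewrite -(drinfeld_pairingE (y := y) hx hy) x_orth // rmorph0.
apply: (green_nondegr (phi_a n) hy) => x hx.
by rewrite -(drinfeld_pairingE (x := x) hx hy) y_orth // rmorph0.
Qed.

Lemma drinfeld_finite_divisible : finite_divisible a M.
Proof.
split=> [n|m]; first exact: twisted_ker_finite (phi_a n).
by have [z zP] := twisted_act_surj emb (phi_a 1) m; exists z.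
Qed.

Lemma adjoint_finite_divisible : finite_divisible a N.
Proof.
split=> [n|m]; first exact: adjoint_ker_finite (phi_a n).
by have [z zP] := adjoint_act_surj emb (phi_a 1) m; exists z.
Qed.

Lemma drinfeld_pairing_galois (sigma : galois_aut emb) n (x : M) (y : N) :
  a ^+ n *: x = 0 -> a ^+ n *: y = 0 ->
  drinfeld_pairing (a ^+ n) (galois_drinfeld sigma x) (galois_adjoint sigma y) =
  drinfeld_pairing (a ^+ n) x y.
Proof.
move=> hx hy; have [l lE] := green_ker_in_Fq hx hy.
rewrite /drinfeld_pairing green_galois -lE; congr (r _).
exact: galois_fix.
Qed.

End DrinfeldPairing.

Theorem proposition10p1
  (Fq : finFieldType) (A : comAlgType Fq) (K : fieldType)
  (i : {rmorphism A -> K}) (oo : discrete_valuation K)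
  (hA : regular_ring i oo)
  (L : fieldType) (iota : {rmorphism A -> L}) (phi : drinfeld_module iota)
  (Lbar : closedFieldType) (emb : {rmorphism L -> Lbar})
  (hLbar : forall z : Lbar, algebraicOver emb z)
  (q : prime_idealr A)
  (q_neq0 : exists2 a, a \in q & a != 0)
  (q_neq_char : ~ (q =i [pred a | iota a == 0]))
  (Aq : comNzRingType) (Kq : fieldType) (j : {rmorphism A -> Aq})
  (k : {rmorphism K -> Kq}) (e : {rmorphism Aq -> Kq})
  (v : discrete_valuation Kq)
  (hq : completion_at i q j k e v) :
  (exists B : {bilinear tate phi emb j e -> tate_adjoint phi emb j e
                 -> residue_dual Fq A j e},
     [/\ forall (sigma : galois_aut emb) t s,
           B (tate_galois sigma t) (tate_adjoint_galois sigma s) = B t s,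
         continuous (fun ts : tate phi emb j e * tate_adjoint phi emb j e =>
           (B ts.1 ts.2 : residue_dual Fq A j e))
       & perfect_pairing B]) /\
  (exists f : {linear Aq^o -> residue_dual Fq A j e}, bijective f).
Proof.
have [a ia va] := uniformizer_exists hq q_neq_char.
split.
  have [||r [r_lin _ r1]] := @separating_linear_form _ _
      (emb \o (iota \o GRing.in_alg A)) Lbar^o [set 0] 1.
  - by split=> // c _ _ -> ->; rewrite /= scaler0 addr0.
  - by apply/eqP; rewrite oner_eq0.
  have pP := drinfeld_adjoint_pairing phi r_lin r1 ia.
  exists (tate_pairing hq va pP); split.
  - move=> sigma; apply: tate_pairing_invariant => n x y.
    exact: drinfeld_pairing_galois.
  - exact: tate_pairing_continuous.
  apply: tate_pairing_perfect; first exact: drinfeld_finite_divisible.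
  exact: adjoint_finite_divisible.
apply: (residue_dual_free hq va).
have [m dep] := function_field_poly_dependent (i a) (regular_curve hA).
exact: (residue_field_span hq va (regular_inj hA) dep).
Qed.
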